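(* Let $s_1,\dots,s_6$ be nonnegative integers and let $w=s_1+\cdots+s_6$. Consider the series of positive terms $$\zeta_{\mathfrak g_2}(s_1,\dots,s_6)=\sum_{m,n=1}^\infty \frac{1}{m^{s_1}n^{s_2}(m+n)^{s_3}(m+2n)^{s_4}(m+3n)^{s_5}(2m+3n)^{s_6}}.$$ (1) The series $\zeta_{\mathfrak g_2}(s_1,\dots,s_6)$ converges if and only if $$w-s_1>1,\qquad w-s_2>1,\qquad\text{and}\qquad w>2 .$$ (2) Assume that the three inequalities in (1) hold and that $(s_1,\dots,s_6)$ is neither of the form $(0,0,0,0,s_5,0)$ nor of the form $(0,0,0,0,0,s_6)$. (a) If moreover $(s_1,\dots,s_6)$ is neither of the form $(0,0,s_3,0,0,0)$ nor of the form $(0,0,0,s_4,0,0)$, then $$\zeta_{\mathfrak g_2}(s_1,\dots,s_6)\in \mathcal{MPV}(w,d\le 2,12),$$ that is, $\zeta_{\mathfrak g_2}(s_1,\dots,s_6)$ is a $\mathbb Q$-linear combination of multi-polylog values of weight $w$, depth at most $2$ and level $12$. (b) In the two exceptional cases $(s_1,\dots,s_6)=(0,0,s_3,0,0,0)$ and $(s_1,\dots,s_6)=(0,0,0,s_4,0,0)$, one has $$\zeta_{\mathfrak g_2}(s_1,\dots,s_6)\in\langle\zeta(w-1),\zeta(w)\rangle_{\mathbb Q},$$ the $\mathbb Q$-vector space spanned by $\zeta(w-1)$ and $\zeta(w)$.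
   Context: For positive integers $s_1,\dots,s_d$, the multi-polylog is $$Li_{s_1,\dots,s_d}(x_1,\dots,x_d)=\sum_{k_1>k_2>\dots>k_d>0}\frac{x_1^{k_1}x_2^{k_2}\cdots x_d^{k_d}}{k_1^{s_1}k_2^{s_2}\cdots k_d^{s_d}} .$$ The number $s_1+\cdots+s_d$ is called its weight and $d$ its depth. For a positive integer $N$, a value $Li_{s_1,\dots,s_d}(x_1,\dots,x_d)$ with all $x_j$ being $N$-th roots of unity (not necessarily primitive) is said to have level $N$. At roots of unity the series converges (as the limit for $K\to\infty$ of the partial sums over $K\ge k_1>\dots>k_d>0$) if and only if $(s_1,x_1)\neq(1,1)$, and only these convergent values are considered. $\mathcal{MPV}(w,d,N)$ denotes the $\mathbb Q$-vector space (inside $\mathbb C$) generated by the multi-polylog values of weight $w$, depth $d$ and level $N$; $\mathcal{MPV}(w,d\le 2,N)$ denotes the $\mathbb Q$-vector space generated by those of weight $w$, level $N$ and depth $1$ or $2$. $\zeta(s)=\sum_{k\ge1}k^{-s}$ is the Riemann zeta function. The series $\zeta_{\mathfrak g_2}$ is the Witten multiple zeta function attached to the exceptional Lie algebra $\mathfrak g_2$. *)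

(* Defs.v *)
From HB Require Import structures.
From mathcomp Require Import all_boot all_order all_algebra.
From mathcomp Require Import all_classical all_reals all_analysis.
From mathcomp.real_closed Require Import complex.
Import Order.TTheory GRing.Theory Num.Theory.
Import numFieldNormedType.Exports.

Set Implicit Arguments.
Unset Strict Implicit.
Unset Printing Implicit Defensive.

Local Open Scope classical_set_scope.
Local Open Scope complex_scope.
Local Open Scope ring_scope.

Definition Qspan (F : unitRingType) (A : set F) : set F :=
  [set z | exists (n : nat) (q : 'I_n -> rat) (v : 'I_n -> F),
    (forall i, A (v i)) /\ z = \sum_(i < n) ratr (q i) * v i].

(* Partial sum over K >= k_1 > ... > k_d > 0; the index k_(i+1) is the value
   at i of a strictly decreasing function k : 'I_d -> 'I_K.+1. *)
Definition Li_partial (R : realType) (d : nat) (s : 'I_d -> nat)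
    (x : 'I_d -> R[i]) (K : nat) : R[i] :=
  \sum_(k : {ffun 'I_d -> 'I_K.+1} |
      [forall i : 'I_d, (0 < k i)%N] &&
      [forall i : 'I_d, forall j : 'I_d, (i < j)%N ==> (k j < k i)%N])
    \prod_(i < d) (x i ^+ k i / (k i)%:R ^+ s i).

(* The regular algebra R[i]^o carries the topology of the modulus on R[i]. *)
Definition Li_cvg (R : realType) (d : nat) (s : 'I_d -> nat)
    (x : 'I_d -> R[i]) : Prop :=
  cvgn (Li_partial s x : nat -> R[i]^o).

Definition Li (R : realType) (d : nat) (s : 'I_d -> nat)
    (x : 'I_d -> R[i]) : R[i] :=
  limn (Li_partial s x : nat -> R[i]^o).

Definition multi_polylog_values (R : realType) (w d N : nat) : set R[i] :=
  [set z | exists (s : 'I_d -> nat) (x : 'I_d -> R[i]),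
    [/\ forall i, (0 < s i)%N,
        (\sum_(i < d) s i)%N = w,
        forall i, N.-unity_root (x i),
        Li_cvg s x
      & z = Li s x]].
Arguments multi_polylog_values : clear implicits.

Definition MPV_le2 (R : realType) (w N : nat) : set R[i] :=
  Qspan (multi_polylog_values R w 1 N `|` multi_polylog_values R w 2 N).
Arguments MPV_le2 : clear implicits.

Definition zeta_g2_term (R : realType) (s1 s2 s3 s4 s5 s6 : nat)
    (p : nat * nat) : \bar R :=
  let: (m, n) := p in
  ((m ^ s1 * n ^ s2 * (m + n) ^ s3 * (m + 2 * n) ^ s4 *
    (m + 3 * n) ^ s5 * (2 * m + 3 * n) ^ s6)%:R^-1)%:E.
Arguments zeta_g2_term : clear implicits.

Definition pos_pairs : set (nat * nat) :=
  [set p | (0 < p.1)%N /\ (0 < p.2)%N].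

Definition zeta_g2_cvg (R : realType) (s1 s2 s3 s4 s5 s6 : nat) : Prop :=
  summable pos_pairs (zeta_g2_term R s1 s2 s3 s4 s5 s6).
Arguments zeta_g2_cvg : clear implicits.

(* Meaningful only under [zeta_g2_cvg], since [fine +oo = 0]. *)
Definition zeta_g2 (R : realType) (s1 s2 s3 s4 s5 s6 : nat) : R :=
  fine (\esum_(p in pos_pairs) zeta_g2_term R s1 s2 s3 s4 s5 s6 p).
Arguments zeta_g2 : clear implicits.

(* Meaningful only for 1 < s. *)
Definition zeta (R : realType) (s : nat) : R :=
  limn (series (fun k => (k.+1%:R ^+ s)^-1 : R)).
Arguments zeta : clear implicits.

(* Main.v *)
Require Import Defs.
From mathcomp Require Import all_boot all_order all_algebra.
From mathcomp Require Import all_classical all_reals all_analysis.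
From mathcomp.real_closed Require Import complex.
From mathcomp Require Import ring lra zify.
Set Implicit Arguments.
Unset Strict Implicit.
Unset Printing Implicit Defensive.
Import Order.TTheory GRing.Theory Num.Theory.
Import numFieldNormedType.Exports.
Local Open Scope classical_set_scope.
Local Open Scope complex_scope.
Local Open Scope ring_scope.

(** The idea is to reduce the series to double sums with only two linear forms,
    and to read such a sum as a depth two sum restricted to a sector and to a
    congruence.

    List the six forms by the slope n/m of the line on which their coefficient
    vector lies: m, m+n, 2m+3n, m+2n, m+3n, n.  If [L], [M], [N] are three of them in
    this order, then [M] is a combination of [L] and [N] with positive rational
    coefficients, whence 1/(L N) = a/(M N) + b/(M L) with a, b > 0.  Applying this
    again and again ([g2_sum_between], [g2_sum_MPV]) lowers the number of forms down
    to two.  All series have nonnegative terms, so the identities hold in the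
    extended reals without any care for convergence; moreover the middle form is
    never m nor n, so the exponents of m and n never grow, and by the convergence
    criterion ([g2_sum_finP]) every series met on the way converges.

    For two forms [a] and [b], the pair (a, b) runs over the points of a sector of
    the plane that satisfy one congruence modulo the determinant of the two
    forms, which is at most 3.  A sector is a difference of half sectors d b < c a
    or c a < d b, up to a ray ([sector_MPV]); the difference is taken on the side
    where both sums converge.  With k = c a and l = d b, the sum of a^-s b^-t over a
    half sector becomes the sum of k^-s l^-t over k > l > 0, restricted to a
    subgroup defined by congruences modulo 2 and 3.  The indicator of a subgroup is a
    combination with rational coefficients of characters k, l |-> x^k y^l, where x
    and y are twelfth roots of unity ([rat_char_dvd]), and each character
    contributes the value Li_{s,t}(x, y) ([char_sum_MPV], [depth2_sum_MPV]).  Rays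
    give depth one values in the same way.

    When a single form m+n or m+2n remains there is nothing to decompose, but
    m+n takes the value k exactly k-1 times, which gives zeta(w-1) - zeta(w), and
    the case of m+2n follows from that one by a parity argument
    ([wedge_parity]). *)

(** * Sums of nonnegative families *)

Section NonnegativeSums.
Variables (R : realType).

Lemma esumZ (T : choiceType) (A : set T) (c : R) (f : T -> R) :
  0 < c -> (forall x, 0 <= f x) ->
  \esum_(x in A) (c * f x)%:E = (c%:E * \esum_(x in A) (f x)%:E)%E.
Proof.
move=> c0 f0.
have le (d : R) (g : T -> R) : 0 < d -> (forall x, 0 <= g x) ->
    (\esum_(x in A) (d * g x)%:E <= d%:E * \esum_(x in A) (g x)%:E)%E.
  move=> d0 g0; apply: ge_ereal_sup => _ [X [finX XA] <-].
  rewrite (_ : (\sum_(x \in X) (d * g x)%:E)%E = (d%:E * \sum_(x \in X) (g x)%:E)%E).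
    apply: lee_wpmul2l; first by rewrite lee_fin ltW.
    by apply: ereal_sup_ubound; exists X.
  rewrite ge0_mule_fsumr; last by move=> x; rewrite lee_fin.
  by apply: eq_fsbigr => x _; rewrite EFinM.
apply/eqP; rewrite eq_le le//=.
have := le c^-1 (fun x => c * f x); rewrite invr_gt0 => /(_ c0).
under eq_esum do rewrite mulKf ?gt_eqF//.
move=> /(_ (fun x => mulr_ge0 (ltW c0) (f0 x))) h.
have := @lee_wpmul2l _ c%:E; rewrite lee_fin => /(_ (ltW c0)) /(_ _ _ h).
by rewrite muleA -EFinM divff ?gt_eqF// mul1e.
Qed.

Lemma esum_subset (T : choiceType) (A B : set T) (f : T -> R) :
  A `<=` B -> (forall x, 0 <= f x) ->
  (\esum_(x in A) (f x)%:E <= \esum_(x in B) (f x)%:E)%E.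
Proof.
move=> AB f0; apply: ge_ereal_sup => _ [X [finX XA] <-].
by apply: ereal_sup_ubound; exists X => //; split => // x /XA /AB.
Qed.

Lemma fsbig_seq_fin (T : choiceType) (s : seq T) (f : T -> R) : uniq s ->
  (\sum_(x \in [set` s]) (f x)%:E)%E = (\sum_(x <- s) f x)%:E.
Proof.
by move=> us; rewrite -fsbig_seq// sumEFin.
Qed.

(** The bridge between the two notions of sum in play: [esum] is a supremum over
    all finite subsets, while multi-polylogs are limits of sums over growing
    boxes. *)
Definition exhausts (T : choiceType) (A : set T) (B : nat -> seq T) : Prop :=
  [/\ forall K, uniq (B K), forall K x, x \in B K -> A x
    & forall x, A x -> \forall K \near \oo, x \in B K].

Lemma exhausts_filter (T : choiceType) (A : set T) (B : nat -> seq T)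
    (D : pred T) : exhausts A B ->
  exhausts (A `&` [set x | D x]) (fun K => [seq x <- B K | D x]).
Proof.
move=> [uB BA AB]; split=> [K|K x|x [/= Ax Dx]].
- by rewrite filter_uniq.
- by rewrite mem_filter => /andP[Dx /BA].
- by apply: filterS (AB _ Ax) => K xB; rewrite mem_filter xB Dx.
Qed.

Lemma esum_exhaust (T : choiceType) (A : set T) (B : nat -> seq T) (f : T -> R)
    (z : R) :
  exhausts A B -> (forall x, 0 <= f x) ->
  \esum_(x in A) (f x)%:E = z%:E ->
  (fun K => \sum_(x <- B K) f x) @ \oo --> z.
Proof.
move=> [uB BA AB] f0 sz.
have leB K : \sum_(x <- B K) f x <= z.
  rewrite -lee_fin -sz -fsbig_seq_fin//; apply: ereal_sup_ubound.
  by exists [set` B K] => //; split => // x /= /BA.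
apply/cvgrPdist_lt => e e0.
have : ((z - e)%:E < \esum_(x in A) (f x)%:E)%E by rewrite sz lte_fin; lra.
move=> /ereal_sup_gt [_ [X [finX XA] <-]] ltX.
have [s Xs] := (finite_seqP _).1 finX.
wlog us : s Xs / uniq s.
  move=> wl; apply: (wl (undup s)); rewrite ?undup_uniq// Xs.
  by apply/seteqP; split => x /=; rewrite mem_undup.
move: ltX; rewrite Xs fsbig_seq_fin// lte_fin => ltX.
have : \forall K \near \oo, all (fun x => x \in B K) s.
  move: XA; rewrite Xs; elim: (s) => [_|x r IHr rA]; first exact: nearW.
  near=> K => /=; apply/andP; split; near: K.
    by apply: AB; apply: rA; rewrite /= mem_head.
  by apply: IHr => y yr; apply: rA; rewrite /= in_cons yr orbT.
apply: filterS => K /allP sB.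
rewrite ger0_norm ?subr_ge0//.
suff : \sum_(x <- s) f x <= \sum_(x <- B K) f x by lra.
rewrite -lee_fin -!fsbig_seq_fin//; apply: lee_fsum_nneg_subset => //.
  by move=> x; rewrite !inE/=; exact: sB.
by move=> x _; rewrite lee_fin.
Unshelve. all: by end_near. Qed.


End NonnegativeSums.

(** * Summability of double series *)

Section Summability.
Variables (R : realType).

Definition pos_nats : set nat := [set k | (0 < k)%N].

Lemma esum_triangle (h : nat -> R) : (forall k, 0 <= h k) ->
  \esum_(p in [set p : nat * nat | (0 < p.2 <= p.1)%N]) (h p.1)%:E =
  \esum_(k in pos_nats) (k%:R * h k)%:E.
Proof.
move=> h0.
rewrite (_ : [set p | _] = pos_nats `*`` (fun k => [set` iota 1 k])); last first.
  apply/seteqP; split => -[k l] /=; rewrite /pos_nats/= mem_iota; last lia.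
  by move=> ?; split; lia.
rewrite -(@esum_esum R nat nat pos_nats _ (fun k _ => (h k)%:E)); last first.
  by move=> *; rewrite lee_fin.
apply: eq_esum => k _.
rewrite -[X in \esum_(j in X) _]set_mem_set esum_fset; last 2 first.
- by rewrite set_mem_set; apply/finite_seqP; exists (iota 1 k).
- by move=> *; rewrite lee_fin.
rewrite set_mem_set fsbig_seq_fin ?iota_uniq//.
by rewrite big_const_seq count_predT size_iota iter_addr_0 mulr_natl.
Qed.

(** By induction, since k^(-3/2) is at most twice the increment of -1/sqrt k. *)
Lemma sum_inv_sqrt_cube (n : nat) :
  \sum_(1 <= k < n.+2) (Num.sqrt (k%:R ^+ 3 : R))^-1 <=
  3 - 2 * (Num.sqrt n.+1%:R)^-1.
Proof.
elim: n => [|n IHn].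
  by rewrite big_nat1 expr1n sqrtr1 invr1; lra.
rewrite big_nat_recr//=; apply: le_trans (lerD IHn (lexx _)) _.
set r := Num.sqrt (n.+1%:R : R); set r' := Num.sqrt (n.+2%:R : R).
have r0 : 0 < r by rewrite sqrtr_gt0 ltr0n.
have r'0 : 0 < r' by rewrite sqrtr_gt0 ltr0n.
have rr' : r <= r' by rewrite ler_sqrt ?ler_nat// ler0n.
have r2 : r ^+ 2 = n.+1%:R by rewrite sqr_sqrtr// ler0n.
have r'2 : r' ^+ 2 = r ^+ 2 + 1.
  by rewrite r2 sqr_sqrtr ?ler0n// [in LHS]mulrSr.
have -> : Num.sqrt (n.+2%:R ^+ 3 : R) = r' ^+ 3.
  rewrite -(@sqr_sqrtr _ n.+2%:R) ?ler0n// -exprM -/r' mulnC exprM.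
  by rewrite sqrtr_sqr ger0_norm// exprn_ge0// ltW.
suff : (r' ^+ 3)^-1 <= 2 * (r^-1 - r'^-1) by lra.
have -> : 2 * (r^-1 - r'^-1) = 2 / (r * r' * (r + r')).
  have -> : r^-1 - r'^-1 = (r' ^+ 2 - r ^+ 2) / (r * r' * (r + r')).
    by field; rewrite !gt_eqF// addr_gt0.
  by rewrite r'2; field; rewrite !gt_eqF// addr_gt0.
rewrite -[leLHS]mul1r ler_pdivrMr ?exprn_gt0// mulrAC ler_pdivlMr; last first.
  by rewrite !mulr_gt0// addr_gt0.
by nra.
Qed.

Lemma summable_inv_sqrt_cube :
  (\esum_(p in pos_pairs)
     (Num.sqrt ((p.1 * p.2)%:R ^+ 3 : R))^-1%:E < +oo)%E.
Proof.
pose u k := (Num.sqrt (k%:R ^+ 3 : R))^-1.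
have u0 k : 0 <= u k by rewrite invr_ge0 sqrtr_ge0.
have U : (\esum_(k in pos_nats) (u k)%:E < +oo)%E.
  apply: (@le_lt_trans _ _ 3%:E); last by rewrite ltry.
  rewrite /pos_nats -(@nneseries_esum _ _ (fun k => (0 < k)%N)); last first.
    by move=> *; rewrite lee_fin.
  apply: lime_le.
    by apply: is_cvg_nneseries => *; rewrite lee_fin.
  apply: nearW => -[|n]; first by rewrite big_geq// lee_fin.
  rewrite big_ltn_cond//= [X in (X <= _)%E](_ : _ = (\sum_(1 <= k < n.+1) u k)%:E); last first.
    by rewrite -sumEFin big_nat_cond [RHS]big_nat_cond; apply: eq_bigl => k; lia.
  rewrite lee_fin; case: n => [|n]; first by rewrite big_geq.
  by apply: le_trans (sum_inv_sqrt_cube n) _; rewrite gerBl mulr_ge0// invr_ge0 sqrtr_ge0.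
have U0 : (0 <= \esum_(k in pos_nats) (u k)%:E)%E.
  by apply: esum_ge0 => *; rewrite lee_fin.
rewrite (_ : pos_pairs = pos_nats `*`` (fun => pos_nats))//.
have -> : (fun p : nat * nat => (Num.sqrt ((p.1 * p.2)%:R ^+ 3 : R))^-1%:E) =
    (fun p => (u p.1 * u p.2)%:E).
  apply/funext => p; rewrite /u -invfM -sqrtrM ?exprn_ge0 ?ler0n//.
  by rewrite -exprMn natrM.
rewrite -(@esum_esum R nat nat pos_nats (fun => pos_nats) (fun k l => (u k * u l)%:E)); last first.
  by move=> *; rewrite lee_fin mulr_ge0.
have [U' eU] : exists U', \esum_(k in pos_nats) (u k)%:E = U'%:E.
  by exists (fine (\esum_(k in pos_nats) (u k)%:E)); rewrite fineK// ge0_fin_numE.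
apply: (@le_lt_trans _ _ (\esum_(k in pos_nats) (U'%:E * (u k)%:E)%E)); last first.
  have U'0 : 0 <= U' by rewrite -lee_fin -eU.
  have -> : (fun k => U'%:E * (u k)%:E)%E = (fun k => (U' * u k)%:E) by [].
  move: U'0; rewrite le_eqVlt => /orP[/eqP <-|U'0].
    by rewrite esum1// => *; rewrite mul0r.
  by rewrite esumZ// eU -EFinM ltry.
apply: le_esum => k k0; have : 0 < u k.
  by rewrite invr_gt0 sqrtr_gt0 exprn_gt0// ltr0n.
by move=> uk; rewrite esumZ// eU muleC.
Qed.

(** Comparison with the product of two convergent series of exponent 3/2; the
    exponent is squared away so that the hypothesis is about natural numbers. *)
Lemma summable_cube (D : nat * nat -> nat) (A : set (nat * nat)) :
  A `<=` pos_pairs ->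
  (forall p, A p -> ((p.1 * p.2) ^ 3 <= D p ^ 2)%N) ->
  (\esum_(p in A) ((D p)%:R^-1 : R)%:E < +oo)%E.
Proof.
move=> Apos le; apply: le_lt_trans summable_inv_sqrt_cube.
apply: (@le_trans _ _ (\esum_(p in A) (Num.sqrt ((p.1 * p.2)%:R ^+ 3 : R))^-1%:E)).
  apply: le_esum => p Ap; have [p1 p2] := Apos _ Ap; rewrite lee_fin.
  have c0 : (0 < (p.1 * p.2) ^ 3)%N by rewrite expn_gt0 muln_gt0 p1 p2.
  have D0 : (0 < D p)%N by have := leq_trans c0 (le _ Ap); case: (D p).
  rewrite lef_pV2 ?posrE ?ltr0n ?sqrtr_gt0 -?natrX ?ltr0n//.
  rewrite -[leRHS]ger0_norm ?ler0n// -sqrtr_sqr ler_sqrt ?sqr_ge0//.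
  by rewrite -natrX ler_nat le.
by apply: esum_subset => // p; rewrite invr_ge0 sqrtr_ge0.
Qed.

(** The exponent 3/2 is balanced: on the side l <= k it is dominated by all the
    pairs of exponents (a, b) for which the double series converges. *)
Lemma cube_le (k l a b : nat) : (0 < l)%N -> (l <= k)%N -> (2 <= a)%N ->
  (3 <= a + b)%N -> ((k * l) ^ 3 <= (k ^ a * l ^ b) ^ 2)%N.
Proof.
move=> l0 lk a2 ab.
have k0 : (0 < k)%N by exact: leq_trans lk.
case: b ab => [|[|b]] ab.
- rewrite expn0 muln1 -expnM (@leq_trans (k ^ 6))%N//.
    by rewrite (_ : 6 = 2 * 3)%N// (expnM k 2 3) leq_exp2r// expnS expn1 leq_mul2l lk orbT.
  by rewrite leq_pexp2l//; lia.
- rewrite expn1 (@leq_trans ((k ^ 2 * l) ^ 2))%N//.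
    by rewrite [X in (_ <= X)%N]expnMn -expnM (_ : 2 * 2 = 3 + 1)%N// expnMn expnD expn1 -mulnA leq_mul2l
       (expnS l 2) leq_mul2r lk !orbT.
  by rewrite leq_exp2r// leq_mul2r leq_pexp2l// orbT.
- rewrite (@leq_trans ((k * l) ^ 4))%N//.
    by rewrite leq_pexp2l// muln_gt0 k0.
  rewrite (_ : 4 = 2 * 2)%N// expnM leq_exp2r// expnMn leq_mul// leq_pexp2l//.
Qed.

Lemma esum_harmonic : \esum_(k in pos_nats) (k%:R^-1 : R)%:E = +oo%E.
Proof.
apply/eqP/negPn/negP => fin.
apply: (@dvg_harmonic R); apply: nnseries_is_cvg => [k|].
  exact: harmonic_ge0.
rewrite nneseries_esumT; last by move=> k; rewrite lee_fin harmonic_ge0.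
move: fin; rewrite -ltey; congr (_ < _)%E.
apply: (@reindex_esum _ _ _ _ _ succn); split => //.
- by move=> a b _ _ [].
- by move=> [|k] //= _; exists k.
Qed.

End Summability.

(** * Convergence of the g2 series *)

(** The coefficients of the six linear forms, listed by increasing slope, that is,
    in the order m, m+n, 2m+3n, m+2n, m+3n, n. *)
Definition form1 (i : 'I_6) : nat := nth 0%N [:: 1; 1; 2; 1; 1; 0]%N i.
Definition form2 (i : 'I_6) : nat := nth 0%N [:: 0; 1; 3; 2; 3; 1]%N i.
Definition form (i : 'I_6) (p : nat * nat) : nat :=
  (form1 i * p.1 + form2 i * p.2)%N.
Definition form_prod (e : 'I_6 -> nat) (p : nat * nat) : nat :=
  (\prod_(i < 6) form i p ^ e i)%N.
Definition weight (e : 'I_6 -> nat) : nat := (\sum_(i < 6) e i)%N.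
Definition g2_sum (R : realType) (e : 'I_6 -> nat) : \bar R :=
  \esum_(p in pos_pairs) ((form_prod e p)%:R^-1 : R)%:E.
Arguments g2_sum : clear implicits.

Lemma form_gt0 i p : pos_pairs p -> (0 < form i p)%N.
Proof.
by case: p => m n [/= m0 n0]; case: i => -[|[|[|[|[|[|//]]]]]] ?;
  rewrite /form /form1 /form2 /=; lia.
Qed.

Lemma form_first p : form ord0 p = p.1.
Proof. by rewrite /form /form1 /form2/= mul1n mul0n addn0. Qed.

Lemma form_last p : form ord_max p = p.2.
Proof. by rewrite /form /form1 /form2/= mul1n mul0n. Qed.

Lemma form_prod_gt0 e p : pos_pairs p -> (0 < form_prod e p)%N.
Proof.
by move=> p0; apply: prodn_gt0 => i; rewrite expn_gt0 form_gt0.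
Qed.

Lemma weight_but (e : 'I_6 -> nat) i :
  (weight e - e i = \sum_(j < 6 | j != i) e j)%N.
Proof. by rewrite /weight (bigD1 i)//= addKn. Qed.

Lemma form_prod_ge e p (i : 'I_6) (b : nat) :
  (forall j, j != i -> (b <= form j p)%N) ->
  (b ^ (weight e - e i) * form i p ^ e i <= form_prod e p)%N.
Proof.
move=> ge; rewrite weight_but expn_sum /form_prod [X in (_ <= X)%N](bigD1 i)//=. rewrite mulnC leq_mul2l.
apply/orP; right; apply: leq_prod => j ji.
by have [->|e0] := posnP (e j); rewrite ?expn0// leq_exp2r// ge.
Qed.

Lemma form_prod_le e p (i : 'I_6) (b : nat) :
  (0 < b)%N -> form i p = 1%N ->
  (forall j, j != i -> (form j p <= 6 * b)%N) ->
  (form_prod e p <= 6 ^ weight e * b ^ (weight e - e i))%N.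
Proof.
move=> b0 fi le; rewrite /form_prod (bigD1 i)//= fi exp1n mul1n.
apply: (@leq_trans ((6 * b) ^ (weight e - e i))).
  rewrite weight_but expn_sum; apply: leq_prod => j ji.
  by have [->|e0] := posnP (e j); rewrite ?expn0// leq_exp2r// le.
by rewrite expnMn leq_mul2r leq_pexp2l ?orbT// leq_subr.
Qed.

Lemma form_prod_le_weight e p : pos_pairs p ->
  (form_prod e p <= (3 * (p.1 + p.2)) ^ weight e)%N.
Proof.
move=> [p1 p2]; rewrite /weight expn_sum; apply: leq_prod => i _.
have [->|e0] := posnP (e i); rewrite ?expn0// leq_exp2r//.
case: i {e0} => -[|[|[|[|[|[|//]]]]]] ?; rewrite /form /form1 /form2 /=; lia.
Qed.

(** Where n <= m, every form but n is at least m, so the term is at most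
    m^-(w-e_n) n^-e_n; symmetrically where m <= n. *)
Lemma g2_sum_fin (R : realType) (e : 'I_6 -> nat) :
  (1 < weight e - e ord0)%N -> (1 < weight e - e ord_max)%N ->
  (2 < weight e)%N -> (g2_sum R e < +oo)%E.
Proof.
move=> w0 w5 w; have le_w i : (e i <= weight e)%N.
  by rewrite /weight (bigD1 i)//= leq_addr.
apply: summable_cube => // -[m n] [/= m0 n0].
have [nm|mn] := leqP n m.
  apply: leq_trans (@cube_le m n (weight e - e ord_max) (e ord_max) _ _ _ _) _ => //.
    by rewrite subnK.
  rewrite leq_exp2r//; apply: leq_trans (@form_prod_ge e (m, n) ord_max m _).
    by rewrite form_last leqnn.
  by case=> -[|[|[|[|[|[|//]]]]]] ? //; rewrite /form /form1 /form2 /=; lia.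
rewrite mulnC; apply: leq_trans (@cube_le n m (weight e - e ord0) (e ord0) _ _ _ _) _ => //.
- exact: ltnW.
- by rewrite subnK.
rewrite leq_exp2r//; apply: leq_trans (@form_prod_ge e (m, n) ord0 n _).
  by rewrite form_first leqnn.
by case=> -[|[|[|[|[|[|//]]]]]] ? //; rewrite /form /form1 /form2 /=; lia.
Qed.

(** The terms along [phi] already dominate a multiple of the harmonic series; this
    is used along the two boundary lines m = 1 and n = 1. *)
Lemma g2_sum_infty_line (R : realType) (e : 'I_6 -> nat) (phi : nat -> nat * nat)
    (C : nat) :
  {in pos_nats &, injective phi} -> (forall k, pos_nats k -> pos_pairs (phi k)) ->
  (forall k, pos_nats k -> (form_prod e (phi k) <= C * k)%N) ->
  g2_sum R e = +oo%E.
Proof.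
move=> inj pos le.
have C0 : (0 < C)%N.
  have := le 1%N isT; rewrite muln1; apply: leq_trans.
  by apply: form_prod_gt0; exact: pos.
have C0R : (0 : R) < C%:R^-1 by rewrite invr_gt0 ltr0n.
apply/eqP; rewrite -leye_eq.
apply: (@le_trans _ _ (\esum_(p in phi @` pos_nats)
    ((form_prod e p)%:R^-1 : R)%:E)); last first.
  by apply: esum_subset => // _ [k k0 <-]; exact: pos.
rewrite (@reindex_esum R nat _ pos_nats _ phi); last by split.
apply: (@le_trans _ _ (\esum_(k in pos_nats) (C%:R^-1 * k%:R^-1 : R)%:E)).
  by rewrite esumZ// esum_harmonic mulry gtr0_sg// mul1e.
apply: le_esum => k k0; have Dk := form_prod_gt0 e (pos _ k0).
rewrite lee_fin -invfM -natrM lef_pV2 ?posrE ?ltr0n ?muln_gt0 ?C0//.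
by rewrite ler_nat le.
Qed.

(** On the triangle n <= m all forms are at most 6 m, and the m terms of the row of
    index m contribute a multiple of 1/m. *)
Lemma g2_sum_infty_weight2 (R : realType) (e : 'I_6 -> nat) :
  weight e = 2 -> g2_sum R e = +oo%E.
Proof.
move=> w2; apply/eqP; rewrite -leye_eq.
(* The constant is abstract so that the unary numeral 36%:R never unfolds. *)
have [C C36] : exists C, C = 36%N by exists 36%N.
have C0 : (0 < C)%N by rewrite C36.
have C0R : (0 : R) < C%:R^-1 by rewrite invr_gt0 ltr0n.
apply: (@le_trans _ _ (\esum_(p in [set p : nat * nat | (0 < p.2 <= p.1)%N])
    ((C * p.1 ^ 2)%:R^-1 : R)%:E)); last first.
  apply: (@le_trans _ _ (\esum_(p in [set p : nat * nat | (0 < p.2 <= p.1)%N])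
    ((form_prod e p)%:R^-1 : R)%:E)); last first.
    by apply: esum_subset => // -[m n] /= /andP[n0 nm]; split => //=; exact: leq_trans nm.
  apply: le_esum => -[m n]/= /andP[n0 nm]; have m0 : (0 < m)%N by exact: leq_trans nm.
  rewrite lee_fin lef_pV2 ?posrE ?ltr0n ?ler_nat ?form_prod_gt0//.
    apply: leq_trans (@form_prod_le_weight e (m, n) _) _ => //=.
    by rewrite w2 C36 (_ : 36 = 6 ^ 2)%N// -expnMn leq_exp2r//; lia.
  by rewrite muln_gt0 expn_gt0 m0 C0.
rewrite (@esum_triangle R (fun m => (C * m ^ 2)%:R^-1))//.
apply: (@le_trans _ _ (\esum_(k in pos_nats) (C%:R^-1 * k%:R^-1 : R)%:E)).
  by rewrite esumZ// esum_harmonic mulry gtr0_sg// mul1e.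
apply: le_esum => k k0; rewrite lee_fin le_eqVlt; apply/orP; left; apply/eqP.
have k0' : (k%:R : R) != 0 by rewrite pnatr_eq0 -lt0n.
have C0' : (C%:R : R) != 0 by rewrite pnatr_eq0 -lt0n.
by rewrite natrM natrX; field; rewrite k0' C0'.
Qed.

Lemma g2_sum_finP (R : realType) (e : 'I_6 -> nat) :
  (g2_sum R e < +oo)%E <->
  [/\ (1 < weight e - e ord0)%N, (1 < weight e - e ord_max)%N & (2 < weight e)%N].
Proof.
split=> [fin|[]]; last exact: g2_sum_fin.
have [w0|w0] := leqP (weight e - e ord0) 1.
  move: fin; rewrite (@g2_sum_infty_line R e (fun k => (1, k)%N) (6 ^ weight e))//.
  - by move=> a b _ _ [].
  - move=> k k0; apply: leq_trans (@form_prod_le e _ ord0 k _ _ _) _ => //.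
    + case=> -[|[|[|[|[|[|//]]]]]] ? _; move: k0;
      rewrite /pos_nats /form /form1 /form2 /=; lia.
    + by rewrite leq_mul2l -[X in (_ <= X)%N]expn1 leq_pexp2l ?orbT.
have [w5|w5] := leqP (weight e - e ord_max) 1.
  move: fin; rewrite (@g2_sum_infty_line R e (fun k => (k, 1)%N) (6 ^ weight e))//.
  - by move=> a b _ _ [].
  - move=> k k0; apply: leq_trans (@form_prod_le e _ ord_max k _ _ _) _ => //.
    + case=> -[|[|[|[|[|[|//]]]]]] ? _; move: k0;
      rewrite /pos_nats /form /form1 /form2 /=; lia.
    + by rewrite leq_mul2l -[X in (_ <= X)%N]expn1 leq_pexp2l ?orbT.
(* The weight is at least 2 by now, and only the value 2 is left to exclude. *)
split=> //; rewrite ltn_neqAle (leq_trans w0) ?leq_subr// andbT.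
by apply/eqP => w2; move: fin; rewrite g2_sum_infty_weight2// -w2.
Qed.

(** * Dominated complex series and partial sums of multi-polylogs *)

Section ComplexSeries.
Variables (R : realType).

Lemma normc_le_ReIm (u v : R) : `|u +i* v| <= (`|u| + `|v|)%:C.
Proof.
rewrite normc_def/= lecR -[leRHS]ger0_norm ?addr_ge0// -sqrtr_sqr ler_wsqrtr//.
rewrite sqrrD !real_normK ?num_real// -addrA lerD2l lerDr.
by rewrite mulrn_wge0// mulr_ge0.
Qed.

Lemma cvg_complex (x y : nat -> R) (a b : R) :
  x @ \oo --> a -> y @ \oo --> b ->
  (fun n => x n +i* y n : R[i]^o) @ \oo --> (a +i* b : R[i]^o).
Proof.
move=> xa yb; apply/cvgrPdist_lt => e; rewrite ltcE => /andP[/eqP /= e0 e1].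
have eE : e = (complex.Re e)%:C by move: e0; case: (e) => ? ? /= ->.
have e2 : 0 < complex.Re e / 2 by rewrite divr_gt0.
move/cvgrPdist_lt/(_ _ e2) : xa => xa; move/cvgrPdist_lt/(_ _ e2) : yb => yb.
near=> n; rewrite eE.
apply: (@le_lt_trans _ _ (`|a - x n| + `|b - y n|)%:C).
  exact: normc_le_ReIm.
rewrite ltcR [ltRHS]splitr ltrD//; near: n; [exact: xa|exact: yb].
Unshelve. all: by end_near. Qed.

Lemma cvg_real_complex (x : nat -> R) (a : R) : x @ \oo --> a ->
  (fun n => (x n)%:C : R[i]^o) @ \oo --> (a%:C : R[i]^o).
Proof.
move=> xa; apply: cvg_complex => //; exact: cvg_cst.
Qed.

(** A dominated real family [u] is the difference of the nonnegative summable
    families [u + v] and [v]; the maximum with 0 only matters outside [A]. *)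
Lemma cvg_dominated_sums (T : choiceType) (A : set T) (B : nat -> seq T)
    (u v : T -> R) :
  exhausts A B -> (forall x, A x -> `|u x| <= v x) -> (forall x, 0 <= v x) ->
  (\esum_(x in A) (v x)%:E < +oo)%E ->
  cvgn (fun K => \sum_(x <- B K) u x).
Proof.
move=> exh uv v0 fin.
have fin_cvg (g : T -> R) : (forall x, 0 <= g x) ->
    (\esum_(x in A) (g x)%:E < +oo)%E -> cvgn (fun K => \sum_(x <- B K) g x).
  move=> g0 gfin; apply/cvg_ex; exists (fine (\esum_(x in A) (g x)%:E)).
  apply: (esum_exhaust exh g0).
  by rewrite fineK// ge0_fin_numE//; apply: esum_ge0 => *; rewrite lee_fin.
pose g x := Num.max 0 (u x + v x).
have g0 x : 0 <= g x by rewrite le_max lexx.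
rewrite (_ : (fun K => _) = (fun K => \sum_(x <- B K) g x) -
    (fun K => \sum_(x <- B K) v x)); last first.
  apply/funext => K; rewrite !fctE -sumrB !big_seq; apply: eq_bigr => x xB.
  have [_ BA _] := exh; have := uv _ (BA _ _ xB); rewrite ler_norml => /andP[h _].
  rewrite /g max_r ?addrK//; lra.
apply: is_cvgB; last exact: fin_cvg.
apply: fin_cvg => //; apply: (@le_lt_trans _ _ (\esum_(x in A) (2 * v x)%:E)).
  apply: le_esum => x /uv; rewrite ler_norml => /andP[h1 h2]; rewrite lee_fin.
  by rewrite /g ge_max mulr_ge0//=; lra.
rewrite esumZ//; have [w ->] : exists w, \esum_(x in A) (v x)%:E = w%:E.
  exists (fine (\esum_(x in A) (v x)%:E)); rewrite fineK// ge0_fin_numE//.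
  by apply: esum_ge0 => *; rewrite lee_fin.
by rewrite -EFinM ltry.
Qed.

Lemma cvg_dominated_complex_sums (T : choiceType) (A : set T) (B : nat -> seq T)
    (u : T -> R[i]) (v : T -> R) :
  exhausts A B -> (forall x, A x -> `|u x| <= (v x)%:C) -> (forall x, 0 <= v x) ->
  (\esum_(x in A) (v x)%:E < +oo)%E ->
  cvgn (fun K => \sum_(x <- B K) u x : R[i]^o).
Proof.
move=> exh uv v0 fin.
have ReIm x : A x -> `|complex.Re (u x)| <= v x /\ `|complex.Im (u x)| <= v x.
  move=> /uv; case: (u x) => a b; rewrite normc_def/= lecR => h.
  by split; apply: le_trans h; rewrite -sqrtr_sqr ler_wsqrtr// ?lerDl ?lerDr sqr_ge0.
have /cvg_ex[a ha] := cvg_dominated_sums exh (fun x Ax => (ReIm x Ax).1) v0 fin.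
have /cvg_ex[b hb] := cvg_dominated_sums exh (fun x Ax => (ReIm x Ax).2) v0 fin.
apply/cvg_ex; exists (a +i* b : R[i]^o).
rewrite (_ : (fun K => _) = (fun K => (\sum_(x <- B K) complex.Re (u x)) +i*
   (\sum_(x <- B K) complex.Im (u x)) : R[i]^o)); first exact: cvg_complex.
apply/funext => K; elim: (B K) => [|x s IHs]; rewrite ?big_nil// !big_cons IHs.
by case: (u x).
Qed.

Definition pair_box K : seq (nat * nat) :=
  [seq p <- [seq (k, l) | k <- iota 0 K.+1, l <- iota 0 K.+1] | (0 < p.2 < p.1)%N].

Lemma pair_box_exhausts :
  exhausts [set p : nat * nat | (0 < p.2 < p.1)%N] pair_box.
Proof.
split=> [K|K p|[k l] /= /andP[l0 lk]].
- by rewrite filter_uniq// allpairs_uniq ?iota_uniq// => -[a b] [c d].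
- by rewrite mem_filter => /andP[].
- exists k => // K /= kK; rewrite mem_filter; apply/andP; split; first exact/andP.
  by apply: allpairs_f; rewrite mem_iota; lia.
Qed.

Lemma iota1_exhausts : exhausts pos_nats (iota 1).
Proof.
split=> [K|K k|k k0]; first exact: iota_uniq.
- by rewrite mem_iota /pos_nats/= => /andP[].
- by exists k => // K /= kK; rewrite mem_iota; move: k0; rewrite /pos_nats/=; lia.
Qed.

Lemma Li_partial1 (s : 'I_1 -> nat) (x : 'I_1 -> R[i]) K :
  Li_partial s x K =
  \sum_(k <- iota 1 K) x ord0 ^+ k / k%:R ^+ s ord0.
Proof.
rewrite /Li_partial (reindex (fun k : 'I_K.+1 => [ffun i : 'I_1 => k])); last first.
  exists (fun f : {ffun 'I_1 -> 'I_K.+1} => f ord0) => [k _|f _].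
    by rewrite ffunE.
  by apply/ffunP => i; rewrite ffunE (ord1 i).
transitivity (\sum_(k < K.+1 | (0 < k)%N) x ord0 ^+ k / k%:R ^+ s ord0).
  apply: eq_big => [k|k _]; last by rewrite big_ord1 ffunE.
  apply/andP/idP => [[/forallP/(_ ord0)]|k0]; first by rewrite ffunE.
  split; first by apply/forallP => i; rewrite ffunE.
  by apply/forallP => i; apply/forallP => j; rewrite !ord1.
rewrite -(big_mkord (fun k => 0 < k)%N (fun k => x ord0 ^+ k / k%:R ^+ s ord0)).
by rewrite big_ltn_cond//= big_nat_cond /index_iota subn1/= [RHS]big_seq;
  apply: eq_bigl => k; rewrite mem_iota; lia.
Qed.

Lemma Li_partial2 (s : 'I_2 -> nat) (x : 'I_2 -> R[i]) K :
  Li_partial s x K =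
  \sum_(p <- pair_box K) (x ord0 ^+ p.1 / p.1%:R ^+ s ord0) *
     (x ord_max ^+ p.2 / p.2%:R ^+ s ord_max).
Proof.
pose F (p : nat * nat) := (x ord0 ^+ p.1 / p.1%:R ^+ s ord0) *
     (x ord_max ^+ p.2 / p.2%:R ^+ s ord_max).
rewrite /Li_partial (reindex (fun p : 'I_K.+1 * 'I_K.+1 =>
    [ffun i : 'I_2 => if i == ord0 then p.1 else p.2])); last first.
  exists (fun f : {ffun 'I_2 -> 'I_K.+1} => (f ord0, f ord_max)) => [[k l] _|f _].
    by rewrite !ffunE.
  apply/ffunP => i; rewrite ffunE; case: eqP => [->//|/eqP].
  by case: i => -[|[|//]] i //= _; congr (f _); apply: val_inj.
transitivity (\sum_(p : 'I_K.+1 * 'I_K.+1 | (0 < p.2 < p.1)%N)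
    F (nat_of_ord p.1, nat_of_ord p.2)).
  apply: eq_big => [[k l]|[k l] _]; last first.
    rewrite big_ord_recl big_ord1 (_ : lift ord0 ord0 = ord_max); last exact: val_inj.
    by rewrite !ffunE.
  apply/andP/andP => [[/forallP/(_ ord_max) + /forallP/(_ ord0)/forallP/(_ ord_max)]|].
    by rewrite !ffunE.
  move=> /= [l0 lk]; split; first by apply/forallP => i; rewrite ffunE; case: ifP => //= _; exact: leq_trans lk.
  apply/forallP => i; apply/forallP => j; rewrite !ffunE; apply/implyP.
  by case: i j => -[|[|//]] ? [] [|[|//]] ?.
rewrite -(pair_big_dep predT (fun k l : 'I_K.+1 => 0 < l < k)%N
   (fun k l : 'I_K.+1 => F (nat_of_ord k, nat_of_ord l)))/=.
have iotaE : iota 0 K.+1 = index_iota 0 K.+1 by rewrite /index_iota subn0.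
rewrite /pair_box big_filter [RHS]big_mkcond iotaE [RHS]big_allpairs_dep big_mkord.
by apply: eq_bigr => k _; rewrite big_mkord big_mkcond.
Qed.

End ComplexSeries.

(** * Rational spans *)

Section RationalSpan.
Variables (R : realType).

Lemma Qspan_sum (F : unitRingType) (A : set F) (I : Type) (r : seq I)
    (q : I -> rat) (v : I -> F) :
  (forall i, A (v i)) -> Qspan A (\sum_(i <- r) ratr (q i) * v i).
Proof.
move=> Av; case: r => [|i0 r].
  exists 0%N, (fun=> 0), (fun=> 0); split; first by case.
  by rewrite big_nil big_ord0.
exists (size (i0 :: r)), (fun k => q (nth i0 (i0 :: r) k)), (fun k => v (nth i0 (i0 :: r) k)).
by split => //; rewrite (big_nth i0) big_mkord.
Qed.

Lemma Qspan_gen (F : numFieldType) (A : set F) (q : rat) (v : F) :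
  A v -> Qspan A (ratr q * v).
Proof.
by move=> Av; have := Qspan_sum [:: tt] (fun=> q) (fun=> Av); rewrite big_seq1.
Qed.

Lemma QspanD (F : numFieldType) (A : set F) (x y : F) :
  Qspan A x -> Qspan A y -> Qspan A (x + y).
Proof.
move=> [n [q [v [Av ->]]]] [n' [q' [v' [Av' ->]]]].
pose q2 (i : 'I_n + 'I_n') := match i with inl i => q i | inr i => q' i end.
pose v2 (i : 'I_n + 'I_n') := match i with inl i => v i | inr i => v' i end.
have := @Qspan_sum F A _ (enum {: 'I_n + 'I_n'}) q2 v2.
by rewrite big_enum/= big_sumType/=; apply; case.
Qed.

Lemma QspanZ (F : numFieldType) (A : set F) (c : rat) (x : F) :
  Qspan A x -> Qspan A (ratr c * x).
Proof.
move=> [n [q [v [Av ->]]]]; exists n, (fun i => c * q i), v; split => //.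
by rewrite mulr_sumr; apply: eq_bigr => i _; rewrite rmorphM mulrA.
Qed.

Lemma QspanB (F : numFieldType) (A : set F) (x y : F) :
  Qspan A x -> Qspan A y -> Qspan A (x - y).
Proof.
move=> Ax Ay; apply: QspanD => //.
by have := QspanZ (-1) Ay; rewrite rmorphN1 mulN1r.
Qed.

(** Stated for extended reals, so that an identity between nonnegative series can
    be used without a separate convergence proof: membership entails finiteness. *)
Definition in_MPV w (x : \bar R) : Prop :=
  exists z : R, x = z%:E /\ MPV_le2 R w 12 z%:C.

Lemma in_MPVD w x y : in_MPV w x -> in_MPV w y -> in_MPV w (x + y)%E.
Proof.
move=> [a [-> Pa]] [b [-> Pb]]; exists (a + b); split => //.
by rewrite rmorphD; apply: QspanD.
Qed.

Lemma in_MPVZ w (q : rat) x : in_MPV w x -> in_MPV w ((ratr q)%:E * x)%E.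
Proof.
move=> [a [-> Pa]]; exists (ratr q * a); split => //.
by rewrite rmorphM fmorph_rat; apply: QspanZ.
Qed.

(** Subtraction in the form used for sectors: [z] is the sum over a half sector and
    [y] the part of it outside the sector. *)
Lemma in_MPV_cancel w x y z : x + y = z -> in_MPV w y -> in_MPV w z -> in_MPV w x.
Proof.
move=> xyz [b [yE Pb]] [c [zE Pc]]; exists (c - b); split; last first.
  by rewrite rmorphB; apply: QspanB.
by move: xyz; rewrite yE zE; case: x => //= a [<-]; rewrite addrK.
Qed.

End RationalSpan.
Arguments in_MPV : clear implicits.

(** * Subgroup indicators as rational combinations of characters *)

Section Characters.
Variables (R : realType).

Definition char_comb (r : seq (rat * R[i] * R[i])) (k l : nat) : R[i] :=
  \sum_(e <- r) ratr e.1.1 * (e.1.2 ^+ k * e.2 ^+ l).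

Definition root12 (r : seq (rat * R[i] * R[i])) : Prop :=
  forall e, e \in r -> e.1.2 ^+ 12 = 1 /\ e.2 ^+ 12 = 1.

(** The indicator of a subgroup of (Z/12)^2 is the average of the characters
    that are trivial on it, hence a combination of characters with rational
    coefficients; for a general coset the coefficients are only cyclotomic, which
    would not give elements of the rational span. *)
Definition rat_char (D : nat -> nat -> bool) : Prop :=
  exists2 r, root12 r & forall k l, (D k l)%:R = char_comb r k l.

Lemma rat_char_and D D' : rat_char D -> rat_char D' ->
  rat_char (fun k l => D k l && D' k l).
Proof.
move=> [r hr Dr] [r' hr' Dr'].
pose pr (e e' : rat * R[i] * R[i]) := (e.1.1 * e'.1.1, e.1.2 * e'.1.2, e.2 * e'.2).
exists [seq pr e e' | e <- r, e' <- r'] => [_ /allpairsP[[e e'] [/= er er' ->]]|k l].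
  by rewrite /= !exprMn !(hr _ er).1 !(hr _ er).2 !(hr' _ er').1 !(hr' _ er').2 mulr1.
rewrite -mulnb natrM Dr Dr' /char_comb big_allpairs_dep big_distrlr/=.
apply: eq_bigr => e _; apply: eq_bigr => e' _.
by rewrite rmorphM !exprMn mulrACA; congr (_ * _); rewrite mulrACA.
Qed.

Lemma ex_cube_root : exists2 rt : R[i], rt ^+ 3 = 1 & 1 + rt + rt ^+ 2 = 0.
Proof.
have [rt] := @solve_monicpoly R[i] 2 (fun=> -1) isT.
rewrite !big_ord_recl big_ord0 /= expr0 expr1 => rt2.
have rt20 : 1 + rt + rt ^+ 2 = 0 by rewrite rt2; ring.
exists rt => //.
have -> : rt ^+ 3 = (rt - 1) * (1 + rt + rt ^+ 2) + 1 by ring.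
by rewrite rt20 mulr0 add0r.
Qed.

(** Orthogonality of the characters of Z/n; the determinants of the forms and the
    slopes of the sectors only involve n = 1, 2, 3. *)
Lemma ex_root_of_unity n : (0 < n <= 3)%N ->
  exists2 rt : R[i], rt ^+ n = 1 &
    forall k, (n %| k)%:R = n%:R^-1 * \sum_(u < n) rt ^+ (u * k) :> R[i].
Proof.
move=> /andP[n0 n3].
suff [rt rt1 rt0] : exists2 rt : R[i], rt ^+ n = 1 &
    forall k, (0 < k < n)%N -> \sum_(u < n) (rt ^+ k) ^+ u = 0.
  exists rt => // k.
  have -> : \sum_(u < n) rt ^+ (u * k) = \sum_(u < n) (rt ^+ (k %% n)) ^+ u.
    apply: eq_bigr => u _; rewrite [LHS](_ : _ = (rt ^+ k) ^+ u).
      by congr (_ ^+ _); rewrite {1}(divn_eq k n) exprD mulnC exprM rt1 expr1n mul1r.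
    by rewrite mulnC exprM.
  rewrite /dvdn; case: posnP => [->|k0].
    under eq_bigr do rewrite expr0 expr1n.
    by rewrite sumr_const card_ord mulVf// pnatr_eq0 -lt0n.
  by rewrite rt0 ?mulr0// k0 ltn_pmod.
move: n n0 n3 => [|[|[|[|//]]]] // _ _.
- by exists 1; [rewrite expr1n|case].
- exists (-1); first by rewrite sqrrN expr1n.
  by move=> [|[|k]]// _; rewrite !big_ord_recl big_ord0/= expr0 !expr1; ring.
- have [rt rt1 rt0] := ex_cube_root; exists rt => // -[|[|[|k]]]// _;
    rewrite !big_ord_recl big_ord0 /= expr0 ?expr1 addr0 addrA //.
  have -> : rt ^+ 2 ^+ bump 0 (bump 0 0) = rt ^+ 3 * rt by rewrite -exprM -exprSr.
  by rewrite rt1 mul1r addrAC.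
Qed.

Lemma rat_char_dvd n x y : (0 < n <= 3)%N ->
  rat_char (fun k l => n %| x * k + y * l)%N.
Proof.
move=> n3; have [rt rt1 rtn] := ex_root_of_unity n3.
have rt12 : rt ^+ 12 = 1.
  have -> : 12%N = (n * (12 %/ n))%N by move: n n3 {rt1 rtn} => [|[|[|[|]]]].
  by rewrite exprM rt1 expr1n.
exists [seq (n%:R^-1, rt ^+ (x * u), rt ^+ (y * u)) | u <- iota 0 n].
  by move=> _ /mapP[u _ ->] /=; rewrite -!exprM ![(_ * 12)%N]mulnC !exprM rt12 !expr1n.
have iotaE : iota 0 n = index_iota 0 n by rewrite /index_iota subn0.
move=> k l; rewrite rtn /char_comb big_map iotaE big_mkord mulr_sumr.
have qn : ratr n%:R^-1 = n%:R^-1 :> R[i] by rewrite fmorphV/= ratr_nat.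
apply: eq_bigr => u _; rewrite /= qn; congr (_ * _).
by rewrite -!exprM -exprD; congr (_ ^+ _); lia.
Qed.

End Characters.
Arguments rat_char : clear implicits.

(** * Restricted zeta sums are multi-polylog values *)

Section RestrictedZetaSums.
Variables (R : realType).

Let invnatC d : (d%:R^-1 : R)%:C = d%:R^-1 :> R[i].
Proof. by rewrite fmorphV/= rmorph_nat. Qed.

Let cvg_sumZ (I : eqType) (r : seq I) (c L : I -> R[i]) (u : I -> nat -> R[i]) :
  (forall i, i \in r -> (u i : nat -> R[i]^o) @ \oo --> (L i : R[i]^o)) ->
  (fun K => \sum_(i <- r) c i * u i K : R[i]^o) @ \oo -->
  (\sum_(i <- r) c i * L i : R[i]^o).
Proof.
elim: r => [|i r IHr] uL.
  rewrite big_nil [X in X @ _](_ : _ = fun=> 0); first exact: cvg_cst.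
  by apply/funext => K; rewrite big_nil.
rewrite big_cons [X in X @ _](_ : _ = fun K => (c i * u i K : R[i]^o) +
  (\sum_(j <- r) c j * u j K : R[i]^o)); last first.
  by apply/funext => K; rewrite big_cons.
apply: cvgD; last by apply: IHr => j jr; apply: uL; rewrite in_cons jr orbT.
apply: (@cvgZr _ R[i]^o); apply: uL; exact: mem_head.
Qed.

(** A sum of f over the points of a set that satisfy D is, by expansion of the
    indicator of D, a rational combination of the sums of f twisted by
    characters; all twisted sums converge since f is summable. *)
Lemma char_sum_MPV (T : choiceType) (A : set T) (B : nat -> seq T) (f : T -> R)
    (k l : T -> nat) (D : nat -> nat -> bool) w
    (V := fun x y => (fun K => \sum_(p <- B K)
        (x ^+ k p * y ^+ l p) * (f p)%:C : R[i]^o)) :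
  exhausts A B -> (forall p, 0 <= f p) -> (\esum_(p in A) (f p)%:E < +oo)%E ->
  rat_char R D ->
  (forall x y : R[i], x ^+ 12 = 1 -> y ^+ 12 = 1 -> cvgn (V x y) ->
     exists2 d, (d = 1 \/ d = 2)%N & multi_polylog_values R w d 12 (limn (V x y))) ->
  in_MPV R w (\esum_(p in A `&` [set p | D (k p) (l p)]) (f p)%:E).
Proof.
move=> exh f0 fin [r hr Dr] val.
set A' := A `&` _.
have [z sz] : exists z, \esum_(p in A') (f p)%:E = z%:E.
  exists (fine (\esum_(p in A') (f p)%:E)); rewrite fineK// ge0_fin_numE//.
    by apply: le_lt_trans fin; apply: esum_subset => // p [].
  by apply: esum_ge0 => *; rewrite lee_fin.
exists z; split => //.
have norm1 (x : R[i]) : x ^+ 12 = 1 -> `|x| = 1.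
  by move=> /(congr1 Num.norm); rewrite normrX normr1 => /eqP;
    rewrite pexpr_eq1// => /eqP.
have Vcvg x y : x ^+ 12 = 1 -> y ^+ 12 = 1 -> cvgn (V x y).
  move=> /norm1 x1 /norm1 y1; apply: (cvg_dominated_complex_sums exh _ f0) fin => p _.
  rewrite !normrM !normrX x1 y1 !expr1n !mul1r normc_def/= expr0n/= addr0.
  by rewrite sqrtr_sqr ger0_norm.
have lim1 : (fun K => \sum_(e <- r) ratr e.1.1 * V e.1.2 e.2 K : R[i]^o) @ \oo -->
    (\sum_(e <- r) ratr e.1.1 * limn (V e.1.2 e.2) : R[i]^o).
  by apply: cvg_sumZ => e er; have [? ?] := hr _ er; exact: Vcvg.
have lim2 : (fun K => \sum_(e <- r) ratr e.1.1 * V e.1.2 e.2 K : R[i]^o) @ \oo -->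
    (z%:C : R[i]^o).
  rewrite [X in X @ _](_ : _ = (fun K =>
      (\sum_(p <- [seq p <- B K | D (k p) (l p)]) f p)%:C : R[i]^o)).
    apply: cvg_real_complex; apply: esum_exhaust sz => //.
    exact: (exhausts_filter (fun p => D (k p) (l p)) exh).
  apply/funext => K; apply/esym.
  under [RHS]eq_bigr do rewrite /V mulr_sumr.
  rewrite exchange_big/= rmorph_sum/= big_filter big_mkcond/=.
  apply: eq_bigr => p _; under eq_bigr do rewrite mulrA.
  by rewrite -mulr_suml -/(char_comb r _ _) -Dr; case: ifP; rewrite ?mul1r ?mul0r.
have -> : z%:C = \sum_(e <- r) ratr e.1.1 * limn (V e.1.2 e.2).
  by apply: (cvg_unique _ lim2 lim1); exact: norm_hausdorff.
rewrite /MPV_le2 big_seq; elim: r hr {Dr lim1 lim2} => [|e r IHr] hr.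
  by rewrite big_nil; exists 0%N, (fun=> 0), (fun=> 0); split; [case|rewrite big_ord0].
rewrite -big_seq big_cons; apply: QspanD.
  have [e1 e2] := hr _ (mem_head _ _); apply: Qspan_gen.
  by have [d [->|->]] := val _ _ e1 e2 (Vcvg _ _ e1 e2); [left|right].
by rewrite big_seq; apply: IHr => e' er; apply: hr; rewrite in_cons er orbT.
Qed.

Lemma depth1_sum_MPV (D : nat -> nat -> bool) w : (2 < w)%N -> rat_char R D ->
  in_MPV R w (\esum_(k in pos_nats `&` [set k | D k k]) ((k ^ w)%:R^-1 : R)%:E).
Proof.
move=> w2 hD; apply: (char_sum_MPV (k := id) (l := id) iota1_exhausts) => //.
  apply: (@le_lt_trans _ _ (\esum_(p in [set (k, k) | k in pos_nats])
     (((p.1 ^ w * p.2 ^ 0)%N%:R)^-1 : R)%:E)).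
    rewrite (@reindex_esum R nat _ pos_nats _ (fun k => (k, k))); last first.
      by split => // a b _ _ [].
    by apply: le_esum => k _ /=; rewrite muln1.
  apply: summable_cube => [_ [k k0 <-]|_ [k k0 <-]]; first by split.
  by apply: cube_le => //=; lia.
move=> x y x1 y1 cv; exists 1%N; first by left.
pose s := fun _ : 'I_1 => w; pose xs := fun _ : 'I_1 => x * y.
have LiE : Li_partial s xs = (fun K => \sum_(p <- iota 1 K)
     (x ^+ p * y ^+ p) * ((p ^ w)%:R^-1 : R)%:C).
  apply/funext => K; rewrite Li_partial1; apply: eq_bigr => p _.
  by rewrite invnatC /xs/s exprMn natrX.
exists s, xs; split.
- by move=> i; rewrite /s; lia.
- by rewrite big_ord1.
- by move=> i; apply/unity_rootP; rewrite exprMn x1 y1 mulr1.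
- by rewrite /Li_cvg LiE.
- by rewrite /Li LiE.
Qed.

Lemma depth2_sum_MPV (D : nat -> nat -> bool) s t :
  (1 < s)%N -> (0 < t)%N -> rat_char R D ->
  in_MPV R (s + t) (\esum_(p in [set p : nat * nat | (0 < p.2 < p.1)%N] `&`
     [set p | D p.1 p.2]) ((p.1 ^ s * p.2 ^ t)%:R^-1 : R)%:E).
Proof.
move=> s1 t0 hD; apply: (char_sum_MPV (k := fst) (l := snd) pair_box_exhausts) => //.
  apply: summable_cube => -[k l] /= /andP[l0 lk].
    by split => //=; lia.
  by apply: cube_le => //=; lia.
move=> x y x1 y1 cv; exists 2%N; first by right.
pose ss := fun i : 'I_2 => if i == ord0 then s else t.
pose xs := fun i : 'I_2 => if i == ord0 then x else y.
have LiE : Li_partial ss xs = (fun K => \sum_(p <- pair_box K)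
     (x ^+ p.1 * y ^+ p.2) * ((p.1 ^ s * p.2 ^ t)%:R^-1 : R)%:C).
  apply/funext => K; rewrite Li_partial2; apply: eq_bigr => p _.
  by rewrite invnatC /xs/ss/= natrM !natrX invfM mulrACA.
exists ss, xs; split.
- by move=> i; rewrite /ss; case: ifP => _ //; lia.
- by rewrite big_ord_recl big_ord1.
- by move=> i; apply/unity_rootP; rewrite /xs; case: ifP.
- by rewrite /Li_cvg LiE.
- by rewrite /Li LiE.
Qed.

End RestrictedZetaSums.

(** * Sums over sectors of plane lattices *)

Section PlaneRegions.
Variables (R : realType).

Definition inv_monomial (s t : nat) (p : nat * nat) : R :=
  (p.1 ^ s * p.2 ^ t)%:R^-1.

Lemma inv_monomial_ge0 s t p : 0 <= inv_monomial s t p.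
Proof. by rewrite invr_ge0. Qed.

(** The image of Z^2 under a pair of the six forms is always cut out by a single
    congruence, modulo their determinant. *)
Definition in_lattice (n x y : nat) (p : nat * nat) : bool :=
  [&& 0 < p.1, 0 < p.2 & n %| x * p.1 + y * p.2]%N.

Definition below (c d n x y : nat) : set (nat * nat) :=
  [set p | in_lattice n x y p && (d * p.2 < c * p.1)%N].
Definition above (c d n x y : nat) : set (nat * nat) :=
  [set p | in_lattice n x y p && (c * p.1 < d * p.2)%N].
Definition on_ray (c d n x y : nat) : set (nat * nat) :=
  [set p | in_lattice n x y p && (c * p.1 == d * p.2)%N].

Lemma inv_monomial_scale (c d s t : nat) p : (0 < c)%N -> (0 < d)%N ->
  inv_monomial s t p =
  (c%:R ^+ s * d%:R ^+ t) * inv_monomial s t (c * p.1, d * p.2)%N.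
Proof.
move=> c0 d0; rewrite /inv_monomial/= !expnMn !natrM !natrX !invfM.
have cs : (c%:R : R) ^+ s != 0 by rewrite expf_neq0// pnatr_eq0 -lt0n.
have ds : (d%:R : R) ^+ t != 0 by rewrite expf_neq0// pnatr_eq0 -lt0n.
by rewrite [RHS]mulrACA !mulVKf.
Qed.

Lemma coprime_dvd_scale (n c d x y a b : nat) : coprime n (c * d) ->
  (n %| x * d * (c * a) + y * c * (d * b))%N = (n %| x * a + y * b)%N.
Proof.
move=> cop; rewrite -[RHS](Gauss_dvdr _ cop); congr (n %| _)%N.
by rewrite mulnDr; congr (_ + _)%N; nia.
Qed.

Lemma rat_char_conditions c d n x y :
  (0 < c <= 3)%N -> (0 < d <= 3)%N -> (0 < n <= 3)%N ->
  rat_char R (fun k l => [&& c %| 1 * k + 0 * l, d %| 0 * k + 1 * l &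
     n %| x * k + y * l])%N.
Proof.
move=> c3 d3 n3; apply: rat_char_and; first exact: rat_char_dvd.
by apply: rat_char_and; exact: rat_char_dvd.
Qed.

Let in_MPV_scale w c d s t x : in_MPV R w x ->
  in_MPV R w ((c%:R ^+ s * d%:R ^+ t : R)%:E * x)%E.
Proof.
move=> h; rewrite (_ : _ * _ = ratr (c%:R ^+ s * d%:R ^+ t)); first exact: in_MPVZ.
by rewrite rmorphM/= !rmorphXn/= !ratr_nat.
Qed.

(** The substitution k = c a, l = d b maps the half sector onto the part of
    k > l > 0 cut out by c | k, d | l and a congruence modulo [n]; since [n] is
    coprime to [c * d], the latter can be written without dividing k and l. *)
Lemma below_MPV c d n x y s t :
  (0 < c <= 3)%N -> (0 < d <= 3)%N -> (0 < n <= 3)%N -> coprime n (c * d) ->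
  (1 < s)%N -> (0 < t)%N ->
  in_MPV R (s + t) (\esum_(p in below c d n x y) (inv_monomial s t p)%:E).
Proof.
move=> c3 d3 n3 cop s1 t0.
have c0 : (0 < c)%N by lia.
have d0 : (0 < d)%N by lia.
under eq_esum do rewrite (inv_monomial_scale s t _ c0 d0).
rewrite esumZ; last 2 first.
- by rewrite mulr_gt0// exprn_gt0// ltr0n.
- by move=> p; exact: inv_monomial_ge0.
apply: in_MPV_scale.
have := depth2_sum_MPV s1 t0 (rat_char_conditions (x * d) (y * c) c3 d3 n3).
rewrite (@reindex_esum R _ _ (below c d n x y) _ (fun p => (c * p.1, d * p.2)%N))//.
split.
- move=> [a b] /= /andP[/and3P[/= a0 b0 nab] lt]; split => /=; first lia.
  by rewrite !mul1n !mul0n addn0 add0n !dvdn_mulr// coprime_dvd_scale.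
- by move=> [a b] [a' b'] _ _ /= [] /eqP + /eqP; rewrite !eqn_pmul2l// => /eqP -> /eqP ->.
- move=> [k l] [/= /andP[l0 lk] /and3P[]].
  rewrite !mul1n !mul0n addn0 add0n => /dvdnP[a ka] /dvdnP[b lb] nkl.
  exists (a, b); last by rewrite /= ka lb ![(_ * c)%N]mulnC ![(_ * d)%N]mulnC.
  move: nkl; rewrite ka lb [(a * c)%N]mulnC [(b * d)%N]mulnC coprime_dvd_scale// => nab.
  by rewrite /below/in_lattice/= nab/=; move: l0 lk; rewrite ka lb; case: a {ka nab}; case: b {lb} => //=; lia.
Qed.

Lemma above_MPV c d n x y s t :
  (0 < c <= 3)%N -> (0 < d <= 3)%N -> (0 < n <= 3)%N -> coprime n (c * d) ->
  (0 < s)%N -> (1 < t)%N ->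
  in_MPV R (s + t) (\esum_(p in above c d n x y) (inv_monomial s t p)%:E).
Proof.
move=> c3 d3 n3 cop s0 t1; rewrite addnC.
have := @below_MPV d c n y x t s d3 c3 n3 _ t1 s0; rewrite mulnC => /(_ cop).
rewrite (@reindex_esum R _ _ (above c d n x y) _ (fun p => (p.2, p.1))); last first.
  split.
  - by move=> [a b] /= /andP[/and3P[/= a0 b0 nab] lt];
      rewrite /below /in_lattice/= a0 b0 addnC nab.
  - by move=> [a b] [a' b'] _ _ /= [-> ->].
  - move=> [a b] /andP[/and3P[/= a0 b0 nab] lt]; exists (b, a) => //.
    by rewrite /above /in_lattice/= a0 b0 addnC nab.
by congr in_MPV; apply: eq_esum => p _; rewrite /inv_monomial/= mulnC.
Qed.

Lemma on_ray_MPV c d n x y s t :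
  (0 < c <= 3)%N -> (0 < d <= 3)%N -> (0 < n <= 3)%N -> coprime n (c * d) ->
  (2 < s + t)%N ->
  in_MPV R (s + t) (\esum_(p in on_ray c d n x y) (inv_monomial s t p)%:E).
Proof.
move=> c3 d3 n3 cop st.
have c0 : (0 < c)%N by lia.
have d0 : (0 < d)%N by lia.
under eq_esum do rewrite (inv_monomial_scale s t _ c0 d0).
rewrite esumZ; last 2 first.
- by rewrite mulr_gt0// exprn_gt0// ltr0n.
- by move=> p; exact: inv_monomial_ge0.
apply: in_MPV_scale.
have := depth1_sum_MPV st (rat_char_conditions (x * d) (y * c) c3 d3 n3).
rewrite (@reindex_esum R _ _ (on_ray c d n x y) _ (fun p => c * p.1)%N); last first.
  split.
  - move=> [a b] /= /andP[/and3P[/= a0 b0 nab] /eqP e].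
    split; first by rewrite /pos_nats/= muln_gt0 c0.
    rewrite /= !mul1n !mul0n addn0 add0n dvdn_mulr// {1 3}e dvdn_mulr//.
    by rewrite coprime_dvd_scale.
  - move=> [a b] [a' b'] /set_mem/andP[_ /= /eqP e] /set_mem/andP[_ /= /eqP e'] /= ee.
    have : (d * b = d * b')%N by rewrite -e -e'.
    by move/eqP: ee => + /eqP; rewrite !eqn_pmul2l// => /eqP -> /eqP ->.
  - move=> k [/= k0 /and3P[]].
    rewrite !mul1n !mul0n addn0 add0n => /dvdnP[a ka] /dvdnP[b kb] nk.
    exists (a, b); last by rewrite /= ka mulnC.
    have a0 : (0 < a)%N by move: k0; rewrite /pos_nats/= ka muln_gt0 => /andP[].
    have b0 : (0 < b)%N by move: k0; rewrite /pos_nats/= kb muln_gt0 => /andP[].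
    move: nk; rewrite {1}ka kb [(a * c)%N]mulnC [(b * d)%N]mulnC coprime_dvd_scale// => nab.
    rewrite /on_ray /in_lattice/= nab/= [(c * a)%N]mulnC [(d * b)%N]mulnC -ka -kb eqxx !andbT.
    by rewrite a0 b0.
congr in_MPV; apply: eq_esum => -[a b] /andP[_ /= /eqP e].
by rewrite /inv_monomial/= -e expnD.
Qed.

Lemma esum_split3 (A A1 A2 A3 : set (nat * nat)) s t :
  A1 `<=` A -> A2 = (A `\` A1) `&` A2 -> A3 = (A `\` A1) `\` A2 ->
  (\esum_(p in A1) (inv_monomial s t p)%:E +
  (\esum_(p in A2) (inv_monomial s t p)%:E +
   \esum_(p in A3) (inv_monomial s t p)%:E) =
  \esum_(p in A) (inv_monomial s t p)%:E)%E.
Proof.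
have ge0 (B : set (nat * nat)) p : B p -> (0 <= (inv_monomial s t p)%:E)%E.
  by move=> _; rewrite lee_fin inv_monomial_ge0.
move=> A1A A2E A3E; rewrite (esumID A1 A)//; last by move=> p; exact: ge0.
have -> : A `&` A1 = A1 by apply/setIidPr.
congr (_ + _)%E; rewrite (esumID A2 (A `&` ~` A1))//; last by move=> p; exact: ge0.
by rewrite -setDE -A2E -setDE -A3E.
Qed.

(** Complementing the sector in [below c2 d2] needs 1 < s, complementing it in
    [above c1 d1] needs 1 < t; one of the two holds since 2 < s + t. *)
Lemma sector_MPV c1 d1 c2 d2 n x y s t :
  (0 < c1 <= 3)%N -> (0 < d1 <= 3)%N -> (0 < c2 <= 3)%N -> (0 < d2 <= 3)%N ->
  (0 < n <= 3)%N -> coprime n (c1 * d1) -> coprime n (c2 * d2) ->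
  (c1 * d2 < c2 * d1)%N -> (0 < s)%N -> (0 < t)%N -> (2 < s + t)%N ->
  in_MPV R (s + t) (\esum_(p in above c1 d1 n x y `&` below c2 d2 n x y)
     (inv_monomial s t p)%:E).
Proof.
move=> hc1 hd1 hc2 hd2 hn cop1 cop2 lt s0 t0 st.
have lowslope a b : (0 < a)%N -> (d1 * b <= c1 * a)%N -> (d2 * b < c2 * a)%N.
  move=> a0 ab; rewrite -(ltn_pmul2l (_ : 0 < d1)%N); last by case/andP: hd1.
  rewrite mulnCA (mulnCA d1) (leq_ltn_trans (n := (d2 * (c1 * a))%N))//.
    by rewrite leq_mul2l ab orbT.
  by rewrite !mulnA ltn_pmul2r// mulnC.
have highslope a b : (0 < a)%N -> (c2 * a <= d2 * b)%N -> (c1 * a < d1 * b)%N.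
  by move=> a0 ab; rewrite ltnNge; apply/negP => /(lowslope _ _ a0); rewrite ltnNge ab.
have lat0 p : in_lattice n x y p -> (0 < p.1)%N by case/andP.
have [s1|s1] := ltnP 1 s.
  apply: (@in_MPV_cancel R _ _ (\esum_(p in below c1 d1 n x y) (inv_monomial s t p)%:E
    + \esum_(p in on_ray c1 d1 n x y) (inv_monomial s t p)%:E)%E
    (\esum_(p in below c2 d2 n x y) (inv_monomial s t p)%:E)).
  - apply: esum_split3; first exact: subIsetr.
    + apply/seteqP; split => -[a b] /=; rewrite /below /above/=; last by case.
      move=> /andP[L h]; rewrite L/=; split; last exact: h.
      by split; [apply: lowslope (lat0 _ L) (ltnW h)|case; lia].
    + apply/seteqP; split => -[a b] /=; rewrite /below /above /on_ray/=.
        move=> /andP[L /eqP h]; rewrite L/=; split; last lia.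
        by split; [apply: lowslope (lat0 _ L) _; rewrite h|case; lia].
      move=> [[/andP[-> h1] h2] h3] /=; apply/negPn/negP => h4.
      by apply: h2; split => //; move: h3 => /negP; lia.
  - by apply: in_MPVD; [exact: below_MPV|exact: on_ray_MPV].
  - exact: below_MPV.
apply: (@in_MPV_cancel R _ _ (\esum_(p in above c2 d2 n x y) (inv_monomial s t p)%:E
    + \esum_(p in on_ray c2 d2 n x y) (inv_monomial s t p)%:E)%E
    (\esum_(p in above c1 d1 n x y) (inv_monomial s t p)%:E)).
- apply: esum_split3; first exact: subIsetl.
  + apply/seteqP; split => -[a b] /=; rewrite /below /above/=; last by case.
    move=> /andP[L h]; rewrite L/=; split; last exact: h.
    by split; [apply: highslope (lat0 _ L) (ltnW h)|case; lia].
  + apply/seteqP; split => -[a b] /=; rewrite /below /above /on_ray/=.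
      move=> /andP[L /eqP h]; rewrite L/=; split; last lia.
      by split; [apply: highslope (lat0 _ L) _; rewrite h|case; lia].
    move=> [[/andP[-> h1] h2] h3] /=; apply/negPn/negP => h4.
    by apply: h2; split => //; move: h3 => /negP; lia.
- by apply: in_MPVD; [apply: above_MPV => //; lia|exact: on_ray_MPV].
- by apply: above_MPV => //; lia.
Qed.

End PlaneRegions.

(** * Sums with two linear forms *)

Section TwoForms.
Variables (R : realType).

Lemma esum_two_forms (i j : 'I_6) s t (S : set (nat * nat))
    (inv : nat * nat -> nat * nat) :
  (forall p, pos_pairs p -> S (form i p, form j p) /\ inv (form i p, form j p) = p) ->
  (forall q, S q -> pos_pairs (inv q) /\ (form i (inv q), form j (inv q)) = q) ->
  \esum_(p in pos_pairs) ((form i p ^ s * form j p ^ t)%:R^-1 : R)%:E =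
  \esum_(q in S) (inv_monomial R s t q)%:E.
Proof.
move=> pS Sp.
rewrite (@reindex_esum R _ _ pos_pairs S (fun p => (form i p, form j p)))//.
split=> [p /pS[]//|p p' /set_mem pp /set_mem pp' /(congr1 inv)|q Sq].
  by rewrite (pS _ pp).2 (pS _ pp').2.
by exists (inv q); have [] := Sp _ Sq.
Qed.

Lemma quadrant_MPV s t : (1 < s)%N -> (1 < t)%N ->
  in_MPV R (s + t) (\esum_(p in pos_pairs) (inv_monomial R s t p)%:E).
Proof.
move=> s1 t1.
rewrite -(@esum_split3 R pos_pairs (below 1 1 1 0 0) (above 1 1 1 0 0) (on_ray 1 1 1 0 0)).
- apply: in_MPVD; first by apply: below_MPV => //; lia.
  by apply: in_MPVD; [apply: above_MPV => //; lia|apply: on_ray_MPV => //; lia].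
- by move=> [a b]; rewrite /below/in_lattice/pos_pairs/=; lia.
- apply/seteqP; split => -[a b]; rewrite /below/above/in_lattice/pos_pairs/=; lia.
- apply/seteqP; split => -[a b]; rewrite /below/above/on_ray/in_lattice/pos_pairs/=; lia.
Qed.

Local Ltac two_forms S f :=
  rewrite (@esum_two_forms _ _ _ _ S f);
  [ | by move=> [m n] [/= m0 n0]; rewrite /pos_pairs /form /form1 /form2
         /below /above /in_lattice /=; split; [lia|congr (_, _); lia]
    | by move=> [m n]; rewrite /pos_pairs /form /form1 /form2
         /below /above /in_lattice /= => h; split; [lia|congr (_, _); lia] ].

(** Cramer's rule: for each of the fifteen pairs of forms, the positivity of m and
    n becomes a sector and their integrality a congruence.  The sector is the whole
    quadrant for the pair (m, n), and a half sector as soon as one of m and n is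
    among the two forms; in these cases the hypotheses on the exponents ensure
    convergence. *)
Lemma two_forms_MPV (i j : 'I_6) s t : (i < j)%N -> (0 < s)%N -> (0 < t)%N ->
  (2 < s + t)%N -> (i = ord0 -> 1 < t)%N -> (j = ord_max -> 1 < s)%N ->
  in_MPV R (s + t)
    (\esum_(p in pos_pairs) ((form i p ^ s * form j p ^ t)%:R^-1 : R)%:E).
Proof.
move=> ij s0 t0 st it js.
have {}it : (i == 0 :> nat) -> (1 < t)%N.
  by move=> /eqP i0; apply: it; apply: val_inj.
have {}js : (j == 5 :> nat) -> (1 < s)%N.
  by move=> /eqP i0; apply: js; apply: val_inj.
case: i j ij it js => -[|[|[|[|[|[|//]]]]]] hi [] [|[|[|[|[|[|//]]]]]] hj //= _ it js.
- two_forms (above 1 1 1 0 0) (fun q : nat * nat => (q.1, q.2 - q.1)%N).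
  by apply: above_MPV => //; exact: it.
- two_forms (above 2 1 3 1 1) (fun q : nat * nat => (q.1, (q.2 - 2 * q.1) %/ 3)%N).
  by apply: above_MPV => //; exact: it.
- two_forms (above 1 1 2 1 1) (fun q : nat * nat => (q.1, (q.2 - q.1) %/ 2)%N).
  by apply: above_MPV => //; exact: it.
- two_forms (above 1 1 3 2 1) (fun q : nat * nat => (q.1, (q.2 - q.1) %/ 3)%N).
  by apply: above_MPV => //; exact: it.
- two_forms pos_pairs (fun q : nat * nat => (q.1, q.2)%N).
  by apply: quadrant_MPV; [exact: js|exact: it].
- two_forms (above 2 1 1 0 0 `&` below 3 1 1 0 0) (fun q : nat * nat => (3 * q.1 - q.2, q.2 - 2 * q.1)%N).
  by apply: sector_MPV.
- two_forms (above 1 1 1 0 0 `&` below 2 1 1 0 0) (fun q : nat * nat => (2 * q.1 - q.2, q.2 - q.1)%N).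
  by apply: sector_MPV.
- two_forms (above 1 1 2 1 1 `&` below 3 1 2 1 1) (fun q : nat * nat => (q.1 - (q.2 - q.1) %/ 2, (q.2 - q.1) %/ 2)%N).
  by apply: sector_MPV.
- two_forms (below 1 1 1 0 0) (fun q : nat * nat => (q.1 - q.2, q.2)%N).
  by apply: below_MPV => //; exact: js.
- two_forms (above 1 2 1 0 0 `&` below 2 3 1 0 0) (fun q : nat * nat => (2 * q.1 - 3 * q.2, 2 * q.2 - q.1)%N).
  by apply: sector_MPV.
- two_forms (above 1 2 3 1 1 `&` below 1 1 3 1 1) (fun q : nat * nat => (q.1 - q.2, (2 * q.2 - q.1) %/ 3)%N).
  by apply: sector_MPV.
- two_forms (below 1 3 2 1 1) (fun q : nat * nat => ((q.1 - 3 * q.2) %/ 2, q.2)%N).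
  by apply: below_MPV => //; exact: js.
- two_forms (above 1 1 1 0 0 `&` below 3 2 1 0 0) (fun q : nat * nat => (3 * q.1 - 2 * q.2, q.2 - q.1)%N).
  by apply: sector_MPV.
- two_forms (below 1 2 1 0 0) (fun q : nat * nat => (q.1 - 2 * q.2, q.2)%N).
  by apply: below_MPV => //; exact: js.
- two_forms (below 1 3 1 0 0) (fun q : nat * nat => (q.1 - 3 * q.2, q.2)%N).
  by apply: below_MPV => //; exact: js.
Qed.

End TwoForms.

(** * Reduction to two forms by partial fractions *)

Section PartialFractions.
Variables (R : realType).

Definition det (i j : 'I_6) : nat := (form1 i * form2 j - form1 j * form2 i)%N.

Lemma det_gt0 (i j : 'I_6) : (i < j)%N -> (0 < det i j)%N.
Proof.
by case: i j => -[|[|[|[|[|[|//]]]]]] hi [] [|[|[|[|[|[|//]]]]]] hj.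
Qed.

(** The forms are listed by increasing slope, so that [form k] lies in the open
    cone spanned by [form i] and [form j] whenever i < k < j. *)
Lemma form_between (i k j : 'I_6) p : (i < k)%N -> (k < j)%N ->
  (det i j * form k p = det k j * form i p + det i k * form j p)%N.
Proof.
case: i k j => -[|[|[|[|[|[|//]]]]]] hi [] [|[|[|[|[|[|//]]]]]] hk [] [|[|[|[|[|[|//]]]]]] hj //= _ _;
  rewrite /det /form /form1 /form2 /=; lia.
Qed.

Definition lower_exp (e : 'I_6 -> nat) (i l : 'I_6) : nat := (e l - (l == i))%N.
Definition raise_exp (e : 'I_6 -> nat) (k l : 'I_6) : nat := (e l + (l == k))%N.
Definition move_exp (e : 'I_6 -> nat) (i k : 'I_6) : 'I_6 -> nat :=
  raise_exp (lower_exp e i) k.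

Lemma form_prod_raise e k p : form_prod (raise_exp e k) p = (form_prod e p * form k p)%N.
Proof.
rewrite /form_prod /raise_exp; under eq_bigr do rewrite expnD.
rewrite big_split/=; congr (_ * _)%N.
rewrite (bigD1 k)//= eqxx expn1 big1 ?muln1// => j /negbTE ->.
exact: expn0.
Qed.

Lemma weight_raise e k : weight (raise_exp e k) = (weight e).+1.
Proof.
rewrite /weight /raise_exp big_split/= -[RHS]addn1; congr (_ + _)%N.
by rewrite (bigD1 k)//= eqxx big1 ?addn0// => j /negbTE ->.
Qed.

Lemma raise_lowerK e i : (0 < e i)%N -> raise_exp (lower_exp e i) i = e.
Proof.
move=> ei; apply/funext => l; rewrite /raise_exp /lower_exp.
by case: eqP => [->|_]; rewrite ?subn0 ?addn0// subnK.
Qed.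

Lemma weight_move e i k : (0 < e i)%N -> weight (move_exp e i k) = weight e.
Proof.
by move=> ei; rewrite /move_exp weight_raise -[in RHS](raise_lowerK ei) weight_raise.
Qed.

Lemma form_prod_move e i k p : (0 < e i)%N ->
  (form_prod (move_exp e i k) p * form i p = form_prod e p * form k p)%N.
Proof.
move=> ei; rewrite /move_exp form_prod_raise -[in RHS](raise_lowerK ei).
by rewrite form_prod_raise mulnAC.
Qed.

(** Partial fractions: divide the relation of [form_between] by
    [det i j * form_prod e * form k]. *)
Lemma g2_sum_between e (i k j : 'I_6) : (i < k)%N -> (k < j)%N ->
  (0 < e i)%N -> (0 < e j)%N ->
  g2_sum R e = ((ratr ((det k j)%:R / (det i j)%:R))%:E * g2_sum R (move_exp e i k)
     + (ratr ((det i k)%:R / (det i j)%:R))%:E * g2_sum R (move_exp e j k))%E.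
Proof.
move=> ik kj ei ej; have ij := ltn_trans ik kj.
have r0 (a b : 'I_6) : (a < b)%N -> (0 : rat) < (det a b)%:R.
  by move=> ab; rewrite ltr0n det_gt0.
have [q1 q2] : (0 : R) < ratr ((det k j)%:R / (det i j)%:R) /\
               (0 : R) < ratr ((det i k)%:R / (det i j)%:R).
  by split; rewrite ltr0q divr_gt0// r0.
rewrite /g2_sum -!esumZ//; try by move=> p; rewrite invr_ge0.
rewrite -esumD; last 2 first.
- by move=> p _; rewrite lee_fin mulr_ge0 ?invr_ge0// ltW.
- by move=> p _; rewrite lee_fin mulr_ge0 ?invr_ge0// ltW.
apply: eq_esum => p p0; rewrite -EFinD; congr EFin.
rewrite !fmorph_div/= !ratr_nat.
have nz (n : nat) : (0 < n)%N -> (n%:R : R) != 0 by rewrite pnatr_eq0 -lt0n.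
have fi := nz _ (form_gt0 i p0); have fj := nz _ (form_gt0 j p0).
have fk := nz _ (form_gt0 k p0); have De := nz _ (form_prod_gt0 e p0).
have dij := nz _ (det_gt0 ij).
have inv_move (l : 'I_6) : (0 < e l)%N -> ((form_prod (move_exp e l k) p)%:R^-1 : R) =
    (form l p)%:R / ((form_prod e p)%:R * (form k p)%:R).
  move=> el; rewrite -natrM -(form_prod_move k p el) natrM invfM mulrCA mulfV ?mulr1//.
  exact: nz (form_gt0 l p0).
rewrite !inv_move//.
have := congr1 (fun n => n%:R : R) (form_between p ik kj).
rewrite /= natrD !natrM => h.
transitivity ((det i j)%:R * (form k p)%:R /
   ((det i j)%:R * ((form_prod e p)%:R * (form k p)%:R)) : R).
  by field; rewrite fk De dij.
by rewrite h; field; rewrite fk De dij.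
Qed.

Lemma g2_sum_move_fin e (i k j : 'I_6) : (i < k)%N -> (k < j)%N ->
  (0 < e i)%N -> (0 < e j)%N -> (g2_sum R e < +oo)%E ->
  (g2_sum R (move_exp e i k) < +oo)%E /\ (g2_sum R (move_exp e j k) < +oo)%E.
Proof.
move=> ik kj ei ej; rewrite !g2_sum_finP !weight_move// => -[w0 w5 w2].
have k0 : k != ord0 by apply: contraTneq ik => ->.
have k5 : k != ord_max by apply: contraTneq kj => ->; rewrite -leqNgt -ltnS.
have le l : ((move_exp e l k) ord0 <= e ord0)%N /\
    ((move_exp e l k) ord_max <= e ord_max)%N.
  rewrite /move_exp /raise_exp /lower_exp ![_ == k]eq_sym (negbTE k0) (negbTE k5).
  by rewrite !addn0 !leq_subr.
have [lei0 lei5] := le i; have [lej0 lej5] := le j.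
by split; split => //; [move: w0|move: w5|move: w0|move: w5] => /leq_trans;
  apply; rewrite leq_sub2l.
Qed.

Definition supp (e : 'I_6 -> nat) : {set 'I_6} := [set i | (0 < e i)%N]%SET.

Lemma supp_move e i k : (0 < e k)%N -> supp (move_exp e i k) \subset supp e.
Proof.
move=> ek; apply/fintype.subsetP => l; rewrite !inE /move_exp /raise_exp /lower_exp.
by case: (l =P k) => [->|_] //; lia.
Qed.

Lemma supp_move1 e i k : (0 < e k)%N -> i != k -> e i = 1%N ->
  supp (move_exp e i k) \proper supp e.
Proof.
move=> ek ik ei; apply/fintype.properP; split; first exact: supp_move.
exists i; rewrite !inE ?ei// /move_exp /raise_exp /lower_exp ei eqxx (negbTE ik).
by [].
Qed.

Lemma two_forms_supp e (i j : 'I_6) : (i < j)%N -> supp e = [set i; j]%SET ->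
  (0 < e i)%N -> (0 < e j)%N ->
  (g2_sum R e < +oo)%E -> in_MPV R (weight e) (g2_sum R e).
Proof.
move=> ij se ei ej.
have e0 l : (l != i) && (l != j) -> e l = 0%N.
  rewrite -negb_or => lij; apply/eqP; rewrite -leqn0 leqNgt.
  by apply: contra lij => el; have : l \in supp e by [rewrite inE]; rewrite se !inE.
have ji : j != i by apply: contraTneq ij => ->; rewrite ltnn.
have wE : weight e = (e i + e j)%N.
  rewrite /weight (bigD1 i)//= (bigD1 j)//= big1 ?addn0// => l /e0 //.
move=> /g2_sum_finP; rewrite wE => -[w0 w5 w2].
have -> : g2_sum R e =
    \esum_(p in pos_pairs) ((form i p ^ e i * form j p ^ e j)%:R^-1 : R)%:E.
  apply: eq_esum => p _; congr (_%:R^-1)%:E.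
  rewrite /form_prod (bigD1 i)//= (bigD1 j)//= big1 ?muln1// => l /e0 ->.
  exact: expn0.
apply: two_forms_MPV => //.
- by move=> i0; move: w0; rewrite -i0 addKn.
- by move=> j5; move: w5; rewrite -j5 addnK.
Qed.

(** The outer induction is on the number of forms that occur.  For three forms
    i < k < j that occur, each partial fraction step lowers the exponent of i or of
    j by one, and the inner induction, on the sum of these two exponents, stops when
    one of them vanishes; the two remaining forms of the triple then still occur. *)
Lemma g2_sum_MPV e : (g2_sum R e < +oo)%E ->
  (exists i j : 'I_6, [/\ i < j, 0 < e i & 0 < e j]%N) ->
  in_MPV R (weight e) (g2_sum R e).
Proof.
have [n] := ubnP #|supp e|; elim: n e => // n IHn e; rewrite ltnS => sn fin ex2.
have [/existsP[i /existsP[k /existsP[j]]]|no3] :=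
    boolP [exists i : 'I_6, exists k : 'I_6, exists j : 'I_6,
      [&& i < k, k < j, 0 < e i, 0 < e k & 0 < e j]%N]; last first.
  have [i [j [ij ei ej]]] := ex2.
  apply: (two_forms_supp ij) => //; apply/eqP; rewrite finset.eqEsubset; apply/andP; split.
    apply/fintype.subsetP => l; rewrite !inE => el; apply: contraNT no3.
    rewrite negb_or => /andP[li lj].
    have [lti|gei] := ltnP l i.
      apply/existsP; exists l; apply/existsP; exists i; apply/existsP; exists j.
      by rewrite lti ij el ei ej.
    have il : (i < l)%N by rewrite ltn_neqAle gei andbT eq_sym.
    have [ltj|gej] := ltnP l j.
      apply/existsP; exists i; apply/existsP; exists l; apply/existsP; exists j.
      by rewrite il ltj el ei ej.
    have jl : (j < l)%N by rewrite ltn_neqAle gej andbT eq_sym.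
    apply/existsP; exists i; apply/existsP; exists j; apply/existsP; exists l.
    by rewrite ij jl el ei ej.
  by apply/fintype.subsetP => l; rewrite !inE => /orP[] /eqP ->.
move=> /and5P[ik kj]; have ij := ltn_trans ik kj.
have nik : i != k by apply: contraTneq ik => ->; rewrite ltnn.
have njk : j != k by apply: contraTneq kj => ->; rewrite ltnn.
have nij : i != j by apply: contraTneq ij => ->; rewrite ltnn.
have [N] := ubnP (e i + e j)%N.
elim: N e sn fin {ex2} => // N IHN e sn fin; rewrite ltnS => eN ei ek ej.
have [fini finj] := g2_sum_move_fin ik kj ei ej fin.
have moveE l a : move_exp e l k a = (e a - (a == l) + (a == k))%N by [].
rewrite (g2_sum_between ik kj ei ej).
apply: in_MPVD; apply: in_MPVZ.
- rewrite -(weight_move k ei); have [ei1|ei1] := leqP (e i) 1.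
    apply: IHn => //; last first.
      exists k, j; rewrite !moveE (negbTE njk) eqxx; split => //; first by lia.
      by rewrite [j == i]eq_sym (negbTE nij); lia.
    apply: leq_trans sn; apply: proper_card; apply: supp_move1 => //; lia.
  apply: IHN => //.
  + by apply: leq_trans sn; apply: subset_leq_card; exact: supp_move.
  + by rewrite !moveE eqxx (negbTE nik) (negbTE njk); lia.
  + by rewrite !moveE eqxx (negbTE nik); lia.
  + by rewrite !moveE eqxx; lia.
  + by rewrite !moveE (negbTE njk) [j == i]eq_sym (negbTE nij); lia.
- rewrite -(weight_move k ej); have [ej1|ej1] := leqP (e j) 1.
    apply: IHn => //; last first.
      exists i, k; rewrite !moveE (negbTE nik) eqxx; split => //; last by lia.
      by rewrite (negbTE nij); lia.
    apply: leq_trans sn; apply: proper_card; apply: supp_move1 => //; lia.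
  apply: IHN => //.
  + by apply: leq_trans sn; apply: subset_leq_card; exact: supp_move.
  + by rewrite !moveE eqxx (negbTE nik) (negbTE njk) (negbTE nij); lia.
  + by rewrite !moveE (negbTE nij) (negbTE nik); lia.
  + by rewrite !moveE eqxx; lia.
  + by rewrite !moveE (negbTE njk) eqxx; lia.
Qed.

End PartialFractions.

(** * Single forms and the Riemann zeta function *)

Section RiemannZeta.
Variables (R : realType).

Lemma esum_zeta s : (1 < s)%N ->
  \esum_(k in pos_nats) ((k ^ s)%:R^-1 : R)%:E = (zeta R s)%:E.
Proof.
move=> s1; set x := (LHS).
have x0 : (0 <= x)%E by apply: esum_ge0 => *; rewrite lee_fin invr_ge0.
have xfin : (x < +oo)%E.
  apply: (@le_lt_trans _ _ (\esum_(p in [set (k, 1%N) | k in pos_nats])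
     ((p.1 ^ s)%:R^-1 : R)%:E)).
    rewrite (@reindex_esum R nat _ pos_nats _ (fun k => (k, 1%N))) //.
    by split => // a b _ _ [].
  apply: summable_cube => [_ [k k0 <-]|_ [k k0 <-]]; first by split.
  apply: leq_trans (@cube_le k 1 2 1 _ _ _ _) _ => //.
  by rewrite muln1 leq_exp2r// leq_pexp2l.
have xE : x = (fine x)%:E by rewrite fineK// ge0_fin_numE.
rewrite xE; congr EFin; apply/esym.
have -> : zeta R s = limn (fun K => \sum_(k <- iota 1 K) (k ^ s)%:R^-1 : R).
  rewrite /zeta; congr (limn _); apply/funext => K.
  rewrite /series/= -(addn0 1%N) iotaDl big_map /index_iota subn0.
  by apply: eq_bigr => k _; rewrite natrX.
apply/cvg_lim => //; apply: (esum_exhaust iota1_exhausts _ xE) => k.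
by rewrite invr_ge0.
Qed.

Definition wedge : set (nat * nat) := [set p | (0 < p.2 < p.1)%N].

(** The triangle 0 < l <= k is the wedge together with its diagonal, and the sum
    of k^-w over its k points of abscissa k is k^-(w-1). *)
Lemma wedge_zeta w : (2 < w)%N ->
  (\esum_(p in wedge) ((p.1 ^ w)%:R^-1 : R)%:E + (zeta R w)%:E =
   (zeta R (w - 1))%:E)%E.
Proof.
move=> w2.
have := @esum_triangle R (fun k => (k ^ w)%:R^-1) (fun k => ltac:(by rewrite invr_ge0)).
have -> : \esum_(k in pos_nats) (k%:R * (k ^ w)%:R^-1 : R)%:E = (zeta R (w - 1))%:E.
  rewrite -esum_zeta; last lia.
  apply: eq_esum => k k0; congr EFin.
  have k0' : (k%:R : R) != 0 by rewrite pnatr_eq0 -lt0n.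
  by rewrite -{1}(subnK (ltnW (ltnW w2))) addn1 expnS natrM invfM mulrA mulfV// mul1r.
move=> <-; rewrite [RHS](esumID wedge); last by move=> *; rewrite lee_fin invr_ge0.
congr (_ + _)%E.
  congr esum; apply/seteqP; split => -[k l]; rewrite /wedge/=; [lia|by case].
rewrite -esum_zeta; last lia.
rewrite [RHS](@reindex_esum R nat _ pos_nats _ (fun k => (k, k)))//.
split.
- by move=> k; rewrite /pos_nats /wedge/=; lia.
- by move=> a b _ _ [].
- move=> [k l]; rewrite /wedge/= => -[h1 h2]; exists k; rewrite /pos_nats/=; first lia.
  by congr pair; move/negP: h2; lia.
Qed.

Lemma esum_sum_form w :
  \esum_(p in pos_pairs) (((p.1 + p.2) ^ w)%:R^-1 : R)%:E =
  \esum_(p in wedge) ((p.1 ^ w)%:R^-1 : R)%:E.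
Proof.
rewrite [RHS](@reindex_esum R _ _ pos_pairs _ (fun p => (p.1 + p.2, p.2)%N))//.
split.
- by move=> [m n]; rewrite /pos_pairs /wedge/=; lia.
- by move=> [a b] [c d] _ _ /= [] *; congr pair; lia.
- move=> [k l]; rewrite /wedge/= => h; exists (k - l, l)%N; rewrite /pos_pairs/=; first lia.
  by congr pair; lia.
Qed.

(** Pairs (k, l) with 0 < l < k split according to the parity of l; those with l
    odd shift to those with l even, up to the boundary k = l + 1. *)
Lemma wedge_parity w :
  (\esum_(p in wedge) ((p.1 ^ w)%:R^-1 : R)%:E =
   \esum_(p in pos_pairs) (((p.1 + 2 * p.2) ^ w)%:R^-1 : R)%:E +
   (\esum_(p in pos_pairs) (((p.1 + 2 * p.2) ^ w)%:R^-1 : R)%:E +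
    \esum_(k in pos_nats) (((2 * k) ^ w)%:R^-1 : R)%:E))%E.
Proof.
have ge0 (A : set (nat * nat)) p : A p -> (0 <= ((p.1 ^ w)%:R^-1 : R)%:E)%E.
  by move=> _; rewrite lee_fin invr_ge0.
rewrite (esumID [set p : nat * nat | ~~ odd p.2]) => [|p]; last exact: ge0.
rewrite (esumID [set p : nat * nat | p.1 != p.2.+1] (_ `&` ~` _)) => [|p]; last exact: ge0.
congr (_ + (_ + _))%E.
- rewrite (@reindex_esum R _ _ pos_pairs _ (fun p => (p.1 + 2 * p.2, 2 * p.2)%N))//.
  split.
  + by move=> [m n]; rewrite /pos_pairs /wedge/=; lia.
  + by move=> [a b] [c d] _ _ /= [] *; congr pair; lia.
  + move=> [k l]; rewrite /wedge/= => h; exists (k - l, l %/ 2)%N; rewrite /pos_pairs/=; first lia.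
    by congr pair; lia.
- rewrite (@reindex_esum R _ _ pos_pairs _ (fun p => (p.1 + 2 * p.2, (2 * p.2).-1)%N))//.
  split.
  + by move=> [m n]; rewrite /pos_pairs /wedge/=; split; [split|]; try (apply/negP); lia.
  + by move=> [a b] [c d] /set_mem + /set_mem + /= []; rewrite /pos_pairs/= => *; congr pair; lia.
  + move=> [k l]; rewrite /wedge/= => -[[h1 /negP h2] h3]; exists (k - l.+1, l.+1 %/ 2)%N; rewrite /pos_pairs/=; first lia.
    by congr pair; lia.
- rewrite (@reindex_esum R _ _ pos_nats _ (fun k => (2 * k, (2 * k).-1)%N))//.
  split.
  + by move=> n; rewrite /pos_nats /wedge/= => ?; split; [split|]; try (apply/negP); lia.
  + by move=> a b _ _ /= []; lia.
  + move=> [k l]; rewrite /wedge/= => -[[h1 /negP h2] /negP h3]; exists (l.+1 %/ 2)%N; rewrite /pos_nats/=; first lia.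
    by congr pair; lia.
Qed.

Lemma sum_form_zeta w : (2 < w)%N ->
  \esum_(p in pos_pairs) (((p.1 + p.2) ^ w)%:R^-1 : R)%:E =
  (zeta R (w - 1) - zeta R w)%:E.
Proof.
move=> w2; rewrite esum_sum_form; have := wedge_zeta w2.
by case: (\esum_(p in wedge) _) => // x [<-]; rewrite addrK.
Qed.

Lemma double_form_zeta w : (2 < w)%N ->
  \esum_(p in pos_pairs) (((p.1 + 2 * p.2) ^ w)%:R^-1 : R)%:E =
  (2^-1 * (zeta R (w - 1) - zeta R w - 2%:R ^- w * zeta R w))%:E.
Proof.
move=> w2; have := wedge_parity w; rewrite -esum_sum_form sum_form_zeta//.
have -> : \esum_(k in pos_nats) (((2 * k) ^ w)%:R^-1 : R)%:E =
    (2%:R ^- w * zeta R w)%:E.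
  rewrite EFinM -esum_zeta ?(ltnW w2)// -esumZ//.
  by apply: eq_esum => k _; rewrite expnMn natrM natrX invfM.
case: (\esum_(p in pos_pairs) _) => // x; rewrite -!EFinD => -[e].
by congr EFin; move: e; set c := _ * zeta R w; lra.
Qed.

End RiemannZeta.

(** * The theorem *)

(** The exponents are permuted to follow the order of the forms by slope. *)
Definition exponents (s1 s2 s3 s4 s5 s6 : nat) (i : 'I_6) : nat :=
  nth 0%N [:: s1; s3; s6; s4; s5; s2] i.

Section Exponents.
Variables (R : realType) (s1 s2 s3 s4 s5 s6 : nat).
Let e := exponents s1 s2 s3 s4 s5 s6.

Lemma weight_exponents : weight e = (s1 + s2 + s3 + s4 + s5 + s6)%N.
Proof.
by rewrite /weight /e /exponents !big_ord_recl big_ord0/=; lia.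
Qed.

Lemma zeta_g2_termE p : zeta_g2_term R s1 s2 s3 s4 s5 s6 p =
  ((form_prod e p)%:R^-1)%:E.
Proof.
case: p => m n; rewrite /zeta_g2_term; congr (_%:R^-1)%:E.
rewrite /form_prod /e /exponents !big_ord_recl big_ord0/= /form/form1/form2/=.
rewrite !mul1n !mul0n addn0 add0n muln1; ring.
Qed.

Lemma zeta_g2_cvgE : zeta_g2_cvg R s1 s2 s3 s4 s5 s6 <-> (g2_sum R e < +oo)%E.
Proof.
rewrite /zeta_g2_cvg /summable (_ : \esum_(x in pos_pairs) _ = g2_sum R e)//.
apply: eq_esum => p _; rewrite zeta_g2_termE gee0_abs// lee_fin invr_ge0//.
Qed.

Lemma zeta_g2E : zeta_g2 R s1 s2 s3 s4 s5 s6 = fine (g2_sum R e).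
Proof. by congr fine; apply: eq_esum => p _; rewrite zeta_g2_termE. Qed.

(** If at most one form occurred, it would be m or n, which the convergence
    conditions rule out, or one of the four others, ruled out explicitly. *)
Lemma exponents_two_forms (s := (s1, s2, s3, s4, s5, s6)) :
  (0 < weight e - e ord0)%N -> (0 < weight e - e ord_max)%N ->
  s <> (0, 0, s3, 0, 0, 0)%N -> s <> (0, 0, 0, s4, 0, 0)%N ->
  s <> (0, 0, 0, 0, s5, 0)%N -> s <> (0, 0, 0, 0, 0, s6)%N ->
  exists i j : 'I_6, [/\ i < j, 0 < e i & 0 < e j]%N.
Proof.
rewrite weight_exponents /= => w0 w5 n3 n4 n5 n6.
have [i ei] : exists i, (0 < e i)%N.
  apply: contrapT => no1.
  have e0' (k : nat) (k6 : (k < 6)%N) : nth 0%N [:: s1; s3; s6; s4; s5; s2] k = 0%N.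
    by apply/eqP; rewrite -leqn0 leqNgt; apply/negP => ek; apply: no1; exists (Ordinal k6).
  move: (e0' 1 isT) (e0' 2 isT) (e0' 3 isT) (e0' 4 isT) (e0' 5 isT)%N.
  by move: w0; rewrite /e/exponents/=; lia.
apply: contrapT => no2.
have zero (k : nat) (k6 : (k < 6)%N) : k != i ->
    nth 0%N [:: s1; s3; s6; s4; s5; s2] k = 0%N.
  move=> ki; apply/eqP; rewrite -leqn0 leqNgt; apply/negP => ek; apply: no2.
  have [lt|lt|eq] := ltngtP k i.
  - by exists (Ordinal k6), i.
  - by exists i, (Ordinal k6).
  - by rewrite eq eqxx in ki.
move: (zero 0 isT) (zero 1 isT) (zero 2 isT) (zero 3 isT) (zero 4 isT) (zero 5 isT)%N.
move: w0 w5 n3 n4 n5 n6; rewrite /e /exponents /s.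
case: i {ei zero no2} => -[|[|[|[|[|[|//]]]]]] hi /= w0 w5 n3 n4 n5 n6 z0 z1 z2 z3 z4 z5.
- by move: (z1 isT) (z2 isT) (z3 isT) (z4 isT) (z5 isT); lia.
- by apply: n3; rewrite (z0 isT) (z2 isT) (z3 isT) (z4 isT) (z5 isT).
- by apply: n6; rewrite (z0 isT) (z1 isT) (z3 isT) (z4 isT) (z5 isT).
- by apply: n4; rewrite (z0 isT) (z1 isT) (z2 isT) (z4 isT) (z5 isT).
- by apply: n5; rewrite (z0 isT) (z1 isT) (z2 isT) (z3 isT) (z5 isT).
- by move: (z0 isT) (z1 isT) (z2 isT) (z3 isT) (z4 isT); lia.
Qed.

End Exponents.

Theorem theorem1p1 (R : realType) (s1 s2 s3 s4 s5 s6 : nat) :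
  let w := (s1 + s2 + s3 + s4 + s5 + s6)%N in
  let ineqs :=
    (1 < w - s1)%N /\ (1 < w - s2)%N /\ (2 < w)%N in
  let s := (s1, s2, s3, s4, s5, s6) in
  (zeta_g2_cvg R s1 s2 s3 s4 s5 s6 <-> ineqs) /\
  (ineqs ->
   s <> (0, 0, 0, 0, s5, 0)%N ->
   s <> (0, 0, 0, 0, 0, s6)%N ->
   (s <> (0, 0, s3, 0, 0, 0)%N ->
    s <> (0, 0, 0, s4, 0, 0)%N ->
    MPV_le2 R w 12 (zeta_g2 R s1 s2 s3 s4 s5 s6)%:C) /\
   (s = (0, 0, s3, 0, 0, 0)%N \/ s = (0, 0, 0, s4, 0, 0)%N ->
    Qspan [set zeta R (w - 1); zeta R w] (zeta_g2 R s1 s2 s3 s4 s5 s6))).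
Proof.
move=> w ineqs s; set e := exponents s1 s2 s3 s4 s5 s6.
have wE : weight e = w := weight_exponents _ _ _ _ _ _.
have cvgE : (g2_sum R e < +oo)%E <-> ineqs.
  by rewrite g2_sum_finP wE; split=> [[]|[? []]].
split; first by rewrite zeta_g2_cvgE.
move=> ine n5 n6; split=> [n3 n4|single].
  have [w0 [w5 w2]] := ine.
  have [] : in_MPV R (weight e) (g2_sum R e).
    apply: g2_sum_MPV; first exact/cvgE.
    by apply: exponents_two_forms => //; rewrite -/e wE; exact: ltnW.
  by rewrite wE => z [gE zM]; rewrite zeta_g2E gE.
have w2 := ine.2.2.
have Qz1 q : Qspan [set zeta R (w - 1); zeta R w] (ratr q * zeta R (w - 1)).
  by apply: Qspan_gen; left.
have Qz q : Qspan [set zeta R (w - 1); zeta R w] (ratr q * zeta R w).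
  by apply: Qspan_gen; right.
have Qz1' := Qz1 1; have Qz' := Qz 1; rewrite rmorph1 !mul1r in Qz1' Qz'.
have term (f : nat * nat -> nat) : (forall p, form_prod e p = f p ^ w)%N ->
    g2_sum R e = \esum_(p in pos_pairs) ((f p ^ w)%:R^-1 : R)%:E.
  by move=> h; apply: eq_esum => p _; rewrite h.
have prodE p : form_prod e p = (p.1 ^ s1 * (p.1 + p.2) ^ s3 *
    (2 * p.1 + 3 * p.2) ^ s6 * (p.1 + 2 * p.2) ^ s4 * (p.1 + 3 * p.2) ^ s5 * p.2 ^ s2)%N.
  rewrite /form_prod /e /exponents !big_ord_recl big_ord0/= /form/form1/form2/=.
  by rewrite !mul1n !mul0n addn0 add0n muln1 !mulnA.
rewrite zeta_g2E -/e; case: single => -[e1 e2 e3 e4 e5].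
  rewrite (term (fun p => p.1 + p.2)%N) => [|p].
    by rewrite sum_form_zeta//; apply: QspanB.
  by rewrite prodE /w e1 e2 e3 e4 e5 !expn0 !muln1 mul1n !addn0 !add0n.
rewrite (term (fun p => p.1 + 2 * p.2)%N) => [|p].
  rewrite double_form_zeta// (_ : _ * _ = ratr 2^-1 *
    (zeta R (w - 1) - zeta R w - ratr (2 ^- w) * zeta R w)).
    by apply: QspanZ; apply: QspanB => //; apply: QspanB.
  by rewrite !fmorphV/= rmorphXn/= ratr_nat.
by rewrite prodE /w e1 e2 e3 e4 e5 !expn0 !muln1 !mul1n !addn0 !add0n.
Qed.
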